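(* Let $H$ be a Hilbert space and $\{w_n\}_{n\in\mathbb N}$ a normalized weakly-null sequence in $H$. Let $K\geq 3$ and let $L_1,\dots,L_K$ be closed subspaces of $H$ such that $$\lim_{n\to\infty}\max\{\operatorname{dist}(w_n,L_k): k\in\{1,\dots,K\}\}=0.$$ Then there exist closed subspaces $\tilde L_k\subset L_k$, $k\in[K]$, a starting point $z_0\in H$, and a sequence of indices $k_1,k_2,\dots\in[K]$ containing each $i\in[K]$ infinitely often, such that the sequence of iterates defined by $z_n=P(\tilde L_{k_n})z_{n-1}$, $n\ge 1$, does not converge in norm.
   Context: $[K]=\{1,\dots,K\}$. For a closed subspace $X$ of $H$, $P(X)$ is the orthogonal projection of $H$ onto $X$. A sequence is normalized if all its members have norm $1$, and weakly-null if it converges weakly to $0$. *)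

(* Defs.v *)
From HB Require Import structures.
From mathcomp Require Import all_boot all_order all_algebra.
From mathcomp Require Import all_classical all_reals all_analysis.
From mathcomp Require Import complex.

Set Implicit Arguments.
Unset Strict Implicit.
Unset Printing Implicit Defensive.

Import Order.TTheory GRing.Theory Num.Theory.
Import numFieldNormedType.Exports.

Local Open Scope classical_set_scope.
Local Open Scope ring_scope.

(* Hilbert spaces are taken over the real or the complex numbers; this index  *)
(* selects the field, so that both cases are treated uniformly.               *)
Variant scalars := RealScalars | ComplexScalars.

Definition scalar_field (R : realType) (s : scalars) : numFieldType :=
  match s with
  | RealScalars => R : numFieldType
  | ComplexScalars => R[i] : numFieldType
  end.

Definition scalar_conj (R : realType) (s : scalars) :
    scalar_field R s -> scalar_field R s :=
  match s with
  | RealScalars => idfun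
  | ComplexScalars => Num.conj : R[i] -> R[i]
  end.

Definition scalar_re (R : realType) (s : scalars) : scalar_field R s -> R :=
  match s with
  | RealScalars => idfun
  | ComplexScalars => @complex.Re R
  end.

(* inner is linear in its first argument and conjugate-linear in the second.  *)
HB.mixin Record hasInner (R : realType) (s : scalars) H
    of CompleteNormedModule (scalar_field R s) H := {
  inner : {dot H for @scalar_conj R s};
  inner_normE : forall x : H, inner x x = `|x| ^+ 2
}.

#[short(type="hilbertType")]
HB.structure Definition Hilbert (R : realType) (s : scalars) :=
  {H of CompleteNormedModule (scalar_field R s) H & hasInner R s H}.

Section HilbertSpace.
Context {R : realType} {s : scalars} {H : hilbertType R s}.

Definition closed_subspace (L : set H) : Prop :=
  closed L /\ submod_closed [in L].

(* A norm takes its values in the scalar field of the space, hence in R[i] in *)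
(* the complex case, where it is a nonnegative real number; scalar_re reads   *)
(* it as an element of R, in which the infimum is defined.                    *)
Definition dist_to (x : H) (L : set H) : R :=
  inf [set scalar_re `|x - y| | y in L].

(* The orthogonal projection of x onto L: the point p of L such that x - p is *)
(* orthogonal to L. By the projection theorem it exists and is unique when L  *)
(* is a closed subspace; 0 is only a default value for other sets.            *)
Definition orth_proj (L : set H) (x : H) : H :=
  xget 0 [set p | L p /\ forall y, L y -> inner (x - p) y = 0].

Definition weakly_null (w : nat -> H) : Prop :=
  forall y : H, inner (w n) y @[n --> \oo] --> (0 : scalar_field R s).

End HilbertSpace.

(* Main.v *)
Require Import Defs.
From HB Require Import structures.
From mathcomp Require Import all_boot all_order all_algebra.
From mathcomp Require Import all_classical all_reals all_analysis.
From mathcomp Require Import complex ring lra.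
Import Order.TTheory GRing.Theory Num.Theory.
Import numFieldNormedType.Exports.

(** Projecting a vector successively onto k lines of a plane, each at angle
    pi / 2k to the one before, turns it through a right angle and keeps the
    fraction cos (pi / 2k) ^ k of its length, which tends to 1.  So suppose
    that e_1, e_2, ... are orthonormal and that a finite word of projections
    carries e_n to within eps_n of e_(n+1), where the eps_n have a small sum.
    As projections are contractions, errors only add up, and the concatenation
    of the words drags e_1 past all the e_n: the iterates are close to e_n at
    the end of the n-th word, hence they do not converge
    ([divergent_iterates]).

    The difficulty is to imitate all these lines with three subspaces.  Let h_j
    be the lines in the plane of e_n and e_(n+1), with unit normals g_j, and
    let S be a self-adjoint contraction with an orthonormal basis of
    eigenvectors y_i.  Suppose that for j < k one of them has eigenvalue
    lam_j < 1 and its projection on the plane is sqrt b_j g_j, and that the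
    other eigenvalues are 1.  Then the compression of S^q to the plane is
      I - sum_i (1 - lam_i^q) b_i g_i g_i^T.
    If the eigenvalues are far enough apart, some power q_j of S kills the
    eigenvectors up to j and spares the later ones ([separated_scales]); if
    the b_i grow fast, the terms before j are negligible
    ([geometric_weights]).  What remains is I - b_j g_j g_j^T, and a high power
    of it is close to the projection onto h_j ([line_projection]); the k lines
    together give [quarter_turn].  The required y_i exist because the vectors
    sqrt b_i g_i can be completed to a tight frame of the plane ([frame_sum]),
    and a tight frame is a projection of an orthonormal basis
    ([inner_eigvec]).  Finally S is P_A P_B P_A where A contains the y_i and B
    is spanned by tilts y_i + mu_i q_i with lam_i = 1 / (1 + mu_i^2)
    ([damp_eigvec]), and the compression to the plane is made by P_C.

    The same three subspaces have to serve every n.  In block n, which is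
    built around e_n and e_(n+1), the tilted subspace is B for n even and C
    for n odd, and the other one has to act as the projection onto the plane.
    That other subspace meets the plane only through its blocks n-1 and n+1,
    and contains e_n and e_(n+1) up to the tilts of these blocks
    ([near_axis], [compression_step]).  There is no vicious circle: the number
    of times that it is applied in stage n depends only on eps_n and K, whereas the
    size of the tilts only influences how often the tilted subspace is applied.
    So one can first fix k, b and the numbers of repetitions for all n, then
    tilts that are tiny for the neighbouring stages, then the powers q_j.

    The subspaces L_k need not have a vector in common.  Weak convergence to 0
    allows one to correct w_n inside each L_k so that it becomes exactly
    orthogonal to finitely many given vectors.  Hence there are unit vectors
    v t k of L_k, nearly independent of k, with v t k orthogonal to v u l
    whenever t and u differ ([orthogonal_clusters]), and the construction above
    is carried out with v t k in place of the t-th basis vector when it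
    concerns the k-th subspace.  The precision of the clusters is fixed last,
    and costs one more error in each of the finitely many steps of a stage.
    All subspaces other than B and C are treated like A, and each word starts
    with every projection once: this is harmless because e_n is close to all
    the subspaces, and it makes every index occur infinitely often. *)

Local Open Scope classical_set_scope.
Local Open Scope ring_scope.

Set Implicit Arguments.
Unset Strict Implicit.
Unset Printing Implicit Defensive.

(** * The scalar field and the inner product *)

Definition of_real (R : realType) (s : scalars) : R -> scalar_field R s :=
  match s with
  | RealScalars => idfun
  | ComplexScalars => real_complex R
  end.

Section Scalars.
Context {R : realType} {s : scalars}.
Local Notation F := (scalar_field R s).
Local Notation of_real := (@of_real R s).
Local Notation conj := (@scalar_conj R s).
Local Notation re := (@scalar_re R s).

Lemma of_real_zmod : zmod_morphism of_real.
Proof. by rewrite /of_real; case: s => x y //=; rewrite rmorphB. Qed.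

Lemma of_real_monoid : monoid_morphism of_real.
Proof. by rewrite /of_real; case: s; split=> // x y; rewrite rmorphM. Qed.

HB.instance Definition _ := GRing.isZmodMorphism.Build R F of_real of_real_zmod.
HB.instance Definition _ :=
  GRing.isMonoidMorphism.Build R F of_real of_real_monoid.

Lemma ler_of_real x y : (of_real x <= of_real y) = (x <= y).
Proof. by rewrite /of_real; case: s => //=; rewrite lecR. Qed.

Lemma of_realK : cancel of_real re.
Proof. by rewrite /of_real /scalar_re; case: s. Qed.

Lemma re_normK (V : normedZmodType F) (x : V) : of_real (re `|x|) = `|x|.
Proof.
have: 0 <= `|x| by [].
move: `|x| => a; rewrite /of_real /scalar_re; clear; case: s a => //= -[a b].
by rewrite lecE /= => /andP[/eqP ->].
Qed.

Lemma conj_of_real x : conj (of_real x) = of_real x.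
Proof.
rewrite /of_real /scalar_conj; case: s => //=.
by apply/CrealP; rewrite complex_real.
Qed.

Lemma conj_mul (a b : F) : conj (a * b) = conj a * conj b.
Proof.
by move: a b; rewrite /scalar_conj; case: s => //= a b; rewrite rmorphM.
Qed.

Lemma conj0 : conj 0 = 0.
Proof. by rewrite -(rmorph0 of_real) conj_of_real. Qed.

End Scalars.

Section Inner.
Context {R : realType} {s : scalars} {H : hilbertType R s}.
Local Notation F := (scalar_field R s).
Local Notation of_real := (@of_real R s).
Local Notation conj := (@scalar_conj R s).
Local Notation re := (@scalar_re R s).
Implicit Types (x y z : H) (a : F).

Lemma innerDl x y z : inner (x + y) z = inner x z + inner y z.
Proof. exact: linearDl. Qed.

Lemma innerZl a x y : inner (a *: x) y = a * inner x y.
Proof. exact: linearZl_LR. Qed.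

Lemma innerC x y : inner x y = conj (inner y x).
Proof. by rewrite hermitian_subproof expr0 mul1r. Qed.

Lemma inner0l x : inner 0 x = 0 :> F.
Proof. by rewrite -(scale0r x) innerZl mul0r. Qed.

Lemma innerNl x y : inner (- x) y = - inner x y.
Proof. by rewrite -scaleN1r innerZl mulN1r. Qed.

Lemma innerBl x y z : inner (x - y) z = inner x z - inner y z.
Proof. by rewrite innerDl innerNl. Qed.

Lemma inner_suml I (r : seq I) (P : pred I) (f : I -> H) z :
  inner (\sum_(i <- r | P i) f i) z = \sum_(i <- r | P i) inner (f i) z.
Proof.
by apply: (big_morph (fun x => inner x z)) => [x y|]; rewrite ?innerDl ?inner0l.
Qed.

Lemma inner_eq0C x y : inner x y = 0 -> inner y x = 0.
Proof. by rewrite [inner y x]innerC => ->; exact: conj0. Qed.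

Lemma innerDr x y z : inner x (y + z) = inner x y + inner x z.
Proof. exact: linearDr. Qed.

Lemma innerZr a x y : inner x (a *: y) = conj a * inner x y.
Proof. by rewrite innerC innerZl conj_mul -innerC. Qed.

Lemma inner0r x : inner x 0 = 0 :> F.
Proof. exact/inner_eq0C/inner0l. Qed.

Lemma innerNr x y : inner x (- y) = - inner x y.
Proof. exact: linearNr. Qed.

Lemma innerBr x y z : inner x (y - z) = inner x y - inner x z.
Proof. by rewrite innerDr innerNr. Qed.

Lemma inner_sumr I (r : seq I) (P : pred I) (f : I -> H) z :
  inner z (\sum_(i <- r | P i) f i) = \sum_(i <- r | P i) inner z (f i).
Proof.
by apply: (big_morph (fun x => inner z x)) => [x y|]; rewrite ?innerDr ?inner0r.
Qed.

Lemma inner_eq0 x : inner x x = 0 :> F -> x = 0.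
Proof.
by rewrite inner_normE => /eqP; rewrite expf_eq0 /= normr_eq0 => /eqP.
Qed.

Lemma pythagoras x y :
  inner x y = 0 -> `|x + y| ^+ 2 = `|x| ^+ 2 + `|y| ^+ 2.
Proof.
move=> xy; rewrite -!inner_normE innerDl !innerDr xy (inner_eq0C xy).
by rewrite addr0 add0r.
Qed.

Lemma cauchy_schwarz x y : `|inner x y| <= `|x| * `|y|.
Proof.
have [->|y0] := eqVneq y 0; first by rewrite inner0r !normr0 mulr0.
have ny : 0 < `|y| by rewrite normr_gt0.
pose p := (inner x y / `|y| ^+ 2) *: y.
have px : inner p (x - p) = 0.
  apply: inner_eq0C; rewrite innerZr innerBl innerZl inner_normE divfK.
    by rewrite subrr mulr0.
  by rewrite expf_neq0 // normr_eq0.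
have: `|p| ^+ 2 <= `|x| ^+ 2.
  by rewrite -(subrKC p x) (pythagoras px) lerDl exprn_ge0.
rewrite ler_pXn2r ?nnegrE // normrZ normrM normfV normrX normr_id.
by rewrite expr2 invfM mulrA divfK ?gt_eqF // ler_pdivrMr.
Qed.

End Inner.

(** * Real-valued norms and orthogonal complements *)

Section Norm.
Context {R : realType} {s : scalars} {H : hilbertType R s}.
Local Notation F := (scalar_field R s).
Local Notation of_real := (@of_real R s).
Local Notation re := (@scalar_re R s).
Implicit Types (x y z : H) (a : F).

(** Norms of vectors are elements of the scalar field, where in the complex case
    neither suprema nor linear arithmetic are available; estimates are done
    with their real values. *)
Definition nrm x : R := re `|x|.

Lemma nrmE x : `|x| = of_real (nrm x).
Proof. by rewrite /nrm re_normK. Qed.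

Lemma nrm_ge0 x : 0 <= nrm x.
Proof. by rewrite -(@ler_of_real R s) -nrmE rmorph0. Qed.

Lemma nrm0 : nrm 0 = 0.
Proof. by rewrite /nrm normr0 -(rmorph0 of_real) of_realK. Qed.

Lemma nrmN x : nrm (- x) = nrm x.
Proof. by rewrite /nrm normrN. Qed.

Lemma nrmC x y : nrm (x - y) = nrm (y - x).
Proof. by rewrite -nrmN opprB. Qed.

Lemma nrm_triangle x y : nrm (x + y) <= nrm x + nrm y.
Proof. by rewrite -(@ler_of_real R s) rmorphD /= -!nrmE ler_normD. Qed.

Lemma nrm_dist z x y : nrm (x - y) <= nrm (x - z) + nrm (z - y).
Proof. by rewrite -(subrKA z) nrm_triangle. Qed.

Lemma norm_of_real (r : R) : `|of_real r| = of_real `|r|.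
Proof.
have [r0|r0] := leP 0 r.
  have : 0 <= of_real r by rewrite -(rmorph0 of_real) ler_of_real.
  by move=> /ger0_norm ->; rewrite ger0_norm.
have : of_real r <= 0 by rewrite -(rmorph0 of_real) ler_of_real ltW.
by move=> /ler0_norm ->; rewrite ltr0_norm // rmorphN.
Qed.

Lemma nrmZ (r : R) x : nrm (of_real r *: x) = `|r| * nrm x.
Proof. by rewrite /nrm normrZ norm_of_real nrmE -rmorphM !of_realK. Qed.

Lemma ler_nrm_sum I (r : seq I) (P : pred I) (f : I -> H) :
  nrm (\sum_(i <- r | P i) f i) <= \sum_(i <- r | P i) nrm (f i).
Proof.
elim/big_ind2: _ => [||//]; first by rewrite nrm0.
by move=> x a y b xa yb; exact: le_trans (nrm_triangle _ _) (lerD xa yb).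
Qed.

Lemma pythagoras_nrm x y :
  inner x y = 0 -> nrm (x + y) ^+ 2 = nrm x ^+ 2 + nrm y ^+ 2.
Proof.
move/pythagoras; rewrite !nrmE -!rmorphXn -rmorphD.
by move/(can_inj (@of_realK R s)).
Qed.

Lemma parallelogram x y :
  nrm (x + y) ^+ 2 + nrm (x - y) ^+ 2 = 2 * nrm x ^+ 2 + 2 * nrm y ^+ 2.
Proof.
apply: (can_inj (@of_realK R s)).
rewrite !(rmorphD, rmorphM, rmorphXn, rmorph_nat) /= -!nrmE.
rewrite -!inner_normE !(innerDl, innerDr, innerNl, innerNr).
ring.
Qed.

Lemma exists_of_real (e : F) : 0 < e -> exists2 r : R, 0 < r & of_real r = e.
Proof.
move=> e0; have ee : of_real (re `|e|) = e by rewrite re_normK gtr0_norm.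
exists (re `|e|) => //; rewrite -(@of_realK R s (re `|e|)).
rewrite lt_def -(inj_eq (can_inj (@of_realK R s))) -(@ler_of_real R s).
by rewrite of_realK ee rmorph0 -lt_def.
Qed.

Lemma ltr_of_real (x y : R) : (of_real x < of_real y) = (x < y).
Proof. by rewrite !lt_def ler_of_real (inj_eq (can_inj (@of_realK R s))). Qed.

(** Transfers convergence, whose neighbourhoods have radii in the scalar field,
    to real estimates. *)
Lemma cvg_nrm (z : nat -> H) (l : H) :
  z n @[n --> \oo] --> l <->
  forall e : R, 0 < e -> exists n0, forall n, (n0 <= n)%N -> nrm (z n - l) < e.
Proof.
split=> [/cvgrPdist_lt zl e e0|zl].
  have := zl (of_real e); rewrite -(rmorph0 of_real) ltr_of_real => /(_ e0).
  move=> [n0 _ zn0]; exists n0 => n /zn0 /=.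
  by rewrite nrmE ltr_of_real nrmC.
apply/cvgrPdist_lt => _ /exists_of_real[e e0 <-].
have [n0 zn0] := zl e e0; exists n0 => // n /= /zn0.
by rewrite nrmE ltr_of_real nrmC.
Qed.

Definition perp (S : set H) : set H :=
  [set x | forall y, S y -> inner x y = 0].

(** The closed subspaces constructed below are double orthogonal complements,
    so that closedness comes once and for all from this lemma, by
    Cauchy-Schwarz. *)
Lemma perp_closed_subspace S : closed_subspace (perp S).
Proof.
split; last first.
  split; first by apply/mem_set => y _; exact: inner0l.
  move=> a x y /set_mem Sx /set_mem Sy; apply/mem_set => z Sz.
  by rewrite innerDl innerZl Sx // Sy // mulr0 addr0.
move=> x Sx y Sy; apply/eqP; rewrite -normr_eq0; apply/negPn/negP => xy0.
pose e := `|inner x y| / (`|y| + 1).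
have y1 : 0 < `|y| + 1 by rewrite ltr_wpDl.
have xy_gt0 : 0 < `|inner x y| by rewrite lt_def xy0 normr_ge0.
have e0 : 0 < e by rewrite divr_gt0.
have [z [Sz]] := Sx _ (nbhsx_ballx x e e0).
rewrite -ball_normE /= => xz.
have le_xy : `|inner x y| <= e * `|y|.
  rewrite -[inner x y]subr0 -(Sz _ Sy) -innerBl.
  by rewrite (le_trans (cauchy_schwarz _ _)) // ler_wpM2r // ltW.
have lt_e : e * `|y| < `|inner x y|.
  rewrite /e mulrAC ltr_pdivrMr // ltr_pM2l // ltrDl; exact: ltr01.
by have := le_lt_trans le_xy lt_e; rewrite ltxx.
Qed.

Implicit Types L S : set H.

Lemma subspaceZD L a x y :
  closed_subspace L -> L x -> L y -> L (a *: x + y).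
Proof. by case=> _ [_ lin] Lx Ly; apply/set_mem/lin; apply/mem_set. Qed.

Lemma subspace0 L : closed_subspace L -> L 0.
Proof. by case=> _ [/set_mem]. Qed.

Lemma subspaceZ L a x : closed_subspace L -> L x -> L (a *: x).
Proof.
move=> cL Lx; rewrite -[_ *: _]addr0; apply: subspaceZD => //.
exact: subspace0.
Qed.

Lemma subspaceD L x y : closed_subspace L -> L x -> L y -> L (x + y).
Proof. by move=> cL Lx Ly; rewrite -[x]scale1r; exact: subspaceZD. Qed.

Lemma subspaceB L x y : closed_subspace L -> L x -> L y -> L (x - y).
Proof. by move=> cL Lx Ly; rewrite addrC -scaleN1r; exact: subspaceZD. Qed.

Lemma subspace_sum L I (r : seq I) (P : pred I) (f : I -> H) :
  closed_subspace L -> (forall i, P i -> L (f i)) ->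
  L (\sum_(i <- r | P i) f i).
Proof.
move=> cL Lf; apply: big_ind => //; first exact: subspace0.
by move=> x y; exact: subspaceD.
Qed.

End Norm.

(** * The projection theorem *)

Section Projection.
Context {R : realType} {s : scalars} {H : hilbertType R s}.
Local Notation of_real := (@of_real R s).
Implicit Types (x y z p : H) (a : scalar_field R s) (L S : set H).

Lemma dist_to_le L x y : L y -> dist_to x L <= nrm (x - y).
Proof.
move=> Ly; apply: ge_inf; last by exists y.
by exists 0 => _ [z _ <-]; exact: nrm_ge0.
Qed.

Lemma dist_to_ge0 L x : L !=set0 -> 0 <= dist_to x L.
Proof.
move=> [y Ly]; apply: lb_le_inf; first by exists (nrm (x - y)), y.
by move=> _ [z _ <-]; exact: nrm_ge0.
Qed.

Lemma dist_to_lt L x (e : R) : L !=set0 -> dist_to x L < e ->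
  exists2 y, L y & nrm (x - y) < e.
Proof.
move=> [y Ly] de; have e0 : 0 < e - dist_to x L by rewrite subr_gt0.
have inf_ok : has_inf [set nrm (x - y) | y in L].
  split; first by exists (nrm (x - y)), y.
  by exists 0 => _ [z _ <-]; exact: nrm_ge0.
have [_ [z Lz <-]] := inf_adherent e0 inf_ok.
by rewrite -/(dist_to x L) subrKC; exists z.
Qed.

(** The classical argument: by the parallelogram law, points of L whose distance
    to x is almost minimal are close to each other, because their midpoint is
    not closer to x than the infimum. *)
Lemma nearest_point L x : closed_subspace L ->
  exists2 p, L p & forall y, L y -> nrm (x - p) <= nrm (x - y).
Proof.
move=> cL; have L0 : L !=set0 by exists 0; exact: subspace0.
set d := dist_to x L.
have d0 : 0 <= d by exact: dist_to_ge0.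
have /choice[u u_near] (n : nat) :
    exists y, L y /\ nrm (x - y) < d + n.+1%:R^-1.
  have [|y Ly xy] := @dist_to_lt L x (d + n.+1%:R^-1) L0; last by exists y.
  by rewrite ltrDl invr_gt0 ltr0n.
have u_close n m : nrm (u n - u m) ^+ 2 <=
    2 * (d + n.+1%:R^-1) ^+ 2 + 2 * (d + m.+1%:R^-1) ^+ 2 - 4 * d ^+ 2.
  have [[Ln xn] [Lm xm]] := (u_near n, u_near m).
  have mid : 2 * d <= nrm ((x - u n) + (x - u m)).
    have <- : of_real 2 *: (x - of_real 2^-1 *: (u n + u m))
            = (x - u n) + (x - u m).
      rewrite scalerBr scalerA -rmorphM mulfV // rmorph1 scale1r.
      by rewrite rmorph_nat scaler_nat mulr2n opprD addrACA.
    rewrite nrmZ ger0_norm // ler_wpM2l // dist_to_le //.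
    by apply: subspaceZ => //; exact: subspaceD.
  have := parallelogram (x - u n) (x - u m).
  have -> : x - u n - (x - u m) = u m - u n by rewrite opprB addrC subrKA.
  have sq (a b : R) : 0 <= a -> a <= b -> a ^+ 2 <= b ^+ 2.
    by move=> a0 ab; rewrite ler_pXn2r ?nnegrE // (le_trans a0).
  have := sq _ _ (mulr_ge0 (ler0n _ 2) d0) mid.
  have := sq _ _ (nrm_ge0 _) (ltW xn).
  have := sq _ _ (nrm_ge0 _) (ltW xm).
  rewrite (nrmC (u n)) exprMn => b_f a_e h_c.
  move: b_f a_e h_c; move: (nrm _ ^+ 2) (nrm _ ^+ 2) (nrm _ ^+ 2) (nrm _ ^+ 2).
  by move: ((_ + _) ^+ 2) ((_ + _) ^+ 2) (d ^+ 2) => *; lra.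
have u_cauchy : cauchy (u @ \oo).
  apply: cauchy_exP => _ /exists_of_real[e e0 <-].
  have e1 : 0 < e ^+ 2 / (8 * d + 4) by rewrite divr_gt0 ?exprn_gt0; lra.
  have [N] := ltr_add_invr e1; rewrite add0r => Ne.
  exists (u N); exists N => // n /= Nn.
  rewrite -ball_normE /= nrmE ltr_of_real.
  have N0 : 0 < N.+1%:R^-1 :> R by rewrite invr_gt0 ltr0n.
  have nN : n.+1%:R^-1 <= N.+1%:R^-1 :> R.
    by rewrite lef_pV2 ?posrE ?ltr0n // ler_nat.
  have n0 : 0 < n.+1%:R^-1 :> R by rewrite invr_gt0 ltr0n.
  have N1 : N.+1%:R^-1 <= 1 :> R by rewrite invf_le1 ?ltr0n // ler1n.
  rewrite -(@ltr_pXn2r _ 2) ?nnegrE ?nrm_ge0 ?ltW //.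
  apply: le_lt_trans (u_close _ _) _.
  move: Ne; rewrite ltr_pdivlMr; last lra.
  set a := _^-1 in N0 nN N1 *; set b := _^-1 in nN n0 *.
  by move=> ae; nra.
have /cauchy_cvgP up := u_cauchy; set p := lim (u @ \oo) in up.
have Lp : L p.
  by apply: (closed_cvg L cL.1 _ p up); near=> n; exact: (u_near n).1.
exists p => // y Ly; apply: le_trans (dist_to_le x Ly); rewrite -/d.
apply/ler_addgt0Pr => e e0; have e2 : 0 < e / 2 by lra.
have [n0 un0] := (cvg_nrm u p).1 up _ e2.
have [N] := ltr_add_invr e2; rewrite add0r => Ne.
set n := maxn n0 N.
have nN : n.+1%:R^-1 <= N.+1%:R^-1 :> R.
  by rewrite lef_pV2 ?posrE ?ltr0n // ler_nat ltnS leq_maxr.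
have := un0 n (leq_maxl _ _); have := (u_near n).2; have := nrm_dist (u n) x p.
by move: (n.+1%:R^-1 : R) (N.+1%:R^-1 : R) Ne nN => *; lra.
Unshelve. all: by end_near.
Qed.

(** If x - p had a component along some y of L, moving p by that component would
    bring it closer to x, by Pythagoras. *)
Lemma projection_theorem L x : closed_subspace L ->
  exists2 p, L p & perp L (x - p).
Proof.
move=> cL; have [p Lp p_min] := nearest_point x cL; exists p => // y Ly.
have [->|y0] := eqVneq y 0; first exact: inner0r.
pose t := inner (x - p) y / `|y| ^+ 2.
have yt : inner (t *: y) (x - p - t *: y) = 0.
  apply: inner_eq0C; rewrite innerZr innerBl innerZl inner_normE divfK.
    by rewrite subrr mulr0.
  by rewrite expf_neq0 // normr_eq0.
have := pythagoras_nrm yt; rewrite subrKC => xp.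
have : nrm (x - p) <= nrm (x - p - t *: y).
  rewrite -addrA -opprD p_min // addrC; exact: subspaceZD.
rewrite -(@ler_pXn2r _ 2) ?nnegrE ?nrm_ge0 // xp gerDr => ty.
have : nrm (t *: y) ^+ 2 = 0 by apply/eqP; rewrite eq_le ty sqr_ge0.
move=> /eqP; rewrite expf_eq0 /= => /eqP ty0.
have /eqP : `|t *: y| = 0 by rewrite nrmE ty0 rmorph0.
rewrite normr_eq0 scaler_eq0 (negPf y0) orbF mulf_eq0 invr_eq0 expf_eq0 /=.
by rewrite normr_eq0 (negPf y0) orbF => /eqP.
Qed.

Section Subspace.
Variables (L : set H) (cL : closed_subspace L).

Lemma orth_projP x : L (orth_proj L x) /\ perp L (x - orth_proj L x).
Proof.
have [p Lp xp] := projection_theorem x cL.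
by apply: (@xgetPex _ 0 [set p | L p /\ perp L (x - p)]); exists p.
Qed.

Lemma orth_proj_uniq x p : L p -> perp L (x - p) -> orth_proj L x = p.
Proof.
have [Lq xq] := orth_projP x; move: (orth_proj L x) Lq xq => q Lq xq Lp xp.
have Lqp : L (q - p) by exact: subspaceB.
apply/subr0_eq/inner_eq0; have := xp _ Lqp; rewrite -(subrKA q x) innerDl.
by rewrite xq // add0r.
Qed.

Lemma orth_proj_id x : L x -> orth_proj L x = x.
Proof.
by move=> Lx; apply: orth_proj_uniq => // y _; rewrite subrr inner0l.
Qed.

Lemma orth_projZD a x y :
  orth_proj L (a *: x + y) = a *: orth_proj L x + orth_proj L y.
Proof.
have [[Lx xp] [Ly yp]] := (orth_projP x, orth_projP y).
apply: orth_proj_uniq => [|z Lz]; first exact: subspaceZD.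
by rewrite opprD addrACA -scalerBr innerDl innerZl xp // yp // mulr0 addr0.
Qed.

Lemma orth_proj0 : orth_proj L 0 = 0.
Proof. by apply: orth_proj_id; exact: subspace0. Qed.

Lemma orth_projD x y : orth_proj L (x + y) = orth_proj L x + orth_proj L y.
Proof. by rewrite -{1}[x]scale1r orth_projZD scale1r. Qed.

Lemma orth_projZ a x : orth_proj L (a *: x) = a *: orth_proj L x.
Proof. by rewrite -{1}[a *: x]addr0 orth_projZD orth_proj0 addr0. Qed.

Lemma orth_projB x y : orth_proj L (x - y) = orth_proj L x - orth_proj L y.
Proof. by rewrite orth_projD -scaleN1r orth_projZ scaleN1r. Qed.

Lemma orth_proj_sum I (r : seq I) (P : pred I) (f : I -> H) :
  orth_proj L (\sum_(i <- r | P i) f i) = \sum_(i <- r | P i) orth_proj L (f i).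
Proof.
exact: (big_morph (orth_proj L) orth_projD orth_proj0).
Qed.

Lemma orth_proj_pyth x :
  nrm x ^+ 2 = nrm (orth_proj L x) ^+ 2 + nrm (x - orth_proj L x) ^+ 2.
Proof.
have [Lx xp] := orth_projP x.
by rewrite -pythagoras_nrm ?subrKC //; apply: inner_eq0C; exact: xp.
Qed.

Lemma nrm_orth_proj x : nrm (orth_proj L x) <= nrm x.
Proof.
by rewrite -(@ler_pXn2r _ 2) ?nnegrE ?nrm_ge0 // [leRHS]orth_proj_pyth lerDl sqr_ge0.
Qed.

(** x - P x does not change when an element of L is subtracted from x, and
    I - P is a contraction. *)
Lemma orth_proj_nearest x y : L y -> nrm (x - orth_proj L x) <= nrm (x - y).
Proof.
move=> Ly; have -> : x - orth_proj L x = x - y - orth_proj L (x - y).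
  by rewrite orth_projB (orth_proj_id Ly) opprB subrKA.
rewrite -(@ler_pXn2r _ 2) ?nnegrE ?nrm_ge0 //.
by rewrite [leRHS]orth_proj_pyth lerDr sqr_ge0.
Qed.

(** Keeps a double complement inside L: if p is the projection of x onto L, then
    x - p is orthogonal to S, hence to x, and to p as well. *)
Lemma perpK_sub S : S `<=` L -> perp (perp S) `<=` L.
Proof.
move=> SL x Sx; have [p Lp xp] := projection_theorem x cL.
suff /subr0_eq -> : x - p = 0 by [].
apply: inner_eq0; rewrite innerBl Sx; last by move=> y /SL /xp.
by rewrite (inner_eq0C (xp _ Lp)) subrr.
Qed.

End Subspace.

Lemma sub_perpK S : S `<=` perp (perp S).
Proof. by move=> x Sx y /(_ _ Sx) /inner_eq0C. Qed.

(** Projections onto a closed span are computed with this criterion, which only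
    tests x - p against the generators. *)
Lemma orth_proj_perpK S x p :
  perp (perp S) p -> perp S (x - p) -> orth_proj (perp (perp S)) x = p.
Proof.
move=> Sp xp; apply: orth_proj_uniq => //; first exact: perp_closed_subspace.
by move=> y /(_ _ xp) /inner_eq0C.
Qed.

End Projection.

(** * Orthogonal clusters of vectors in the given subspaces *)

Section Atoms.
Context {R : realType} {s : scalars} {H : hilbertType R s}.
Local Notation F := (scalar_field R s).
Local Notation of_real := (@of_real R s).
Local Notation re := (@scalar_re R s).
Implicit Types (x y z : H) (a : F) (L S : set H).
Variable w : nat -> H.

(** What remains of the hypothesis on the distances: unlike the distances
    themselves, it passes from S to the kernel of a functional on S without any
    computation of nearest points. *)
Definition asymptotically_in S := forall e : R, 0 < e ->
  exists n0, forall n, (n0 <= n)%N -> exists2 x, S x & nrm (x - w n) < e.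

Lemma re_normD a b : re `|a + b| <= re `|a| + re `|b|.
Proof. by rewrite -(@ler_of_real R s) rmorphD /= !re_normK ler_normD. Qed.

Lemma re_normM a b : re `|a * b| = re `|a| * re `|b|.
Proof. by apply: (can_inj (@of_realK R s)); rewrite rmorphM /= !re_normK normrM. Qed.

Lemma nrmZ_norm a x : nrm (a *: x) = re `|a| * nrm x.
Proof. by rewrite /nrm normrZ -(re_normK a) -(re_normK x) -rmorphM !of_realK. Qed.

Lemma cauchy_schwarz_re x y : re `|inner x y| <= nrm x * nrm y.
Proof.
rewrite -(@ler_of_real R s) rmorphM /= -!nrmE re_normK; exact: cauchy_schwarz.
Qed.

Hypothesis w_weakly_null : weakly_null w.

Lemma weakly_null_lt y (e : R) : 0 < e ->
  exists n0, forall n, (n0 <= n)%N -> re `|inner (w n) y| < e.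
Proof.
move=> e0; have /cvgrPdist_lt/(_ (of_real e)) := w_weakly_null y.
rewrite -(rmorph0 of_real) ltr_of_real => /(_ e0)[n0 _ wn0].
exists n0 => n /wn0 /=.
by rewrite rmorph0 sub0r normrN -(ltr_of_real (s := s)) re_normK.
Qed.

(** If some x0 of S is not orthogonal to f, elements of S near w_n are corrected
    by a multiple of x0; the multiple is small because w_n is almost orthogonal
    to f. *)
Lemma asymptotically_in_kernel S f :
  (forall a x y, S x -> S y -> S (a *: x + y)) -> asymptotically_in S ->
  asymptotically_in [set x | S x /\ inner x f = 0].
Proof.
move=> linS wS; have [[x0 [Sx0 x0f]]|Sf] :=
  pselect (exists x, S x /\ inner x f != 0); last first.
  move=> e /wS[n0 wn0]; exists n0 => n /wn0[x Sx xw]; exists x => //; split=> //.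
  by apply/eqP/negPn/negP => xf; apply: Sf; exists x.
pose c := re `|(inner x0 f)^-1| * nrm x0.
have c0 : 0 <= c by rewrite /c -nrmZ_norm nrm_ge0.
move=> e e0; pose e1 := e / (1 + (nrm f + 1) * c).
have d0 : 0 < 1 + (nrm f + 1) * c.
  by rewrite ltr_wpDr // mulr_ge0 // addr_ge0 ?nrm_ge0.
have e10 : 0 < e1 by rewrite divr_gt0.
have [n1 wn1] := wS _ e10; have [n2 wn2] := weakly_null_lt f e10.
exists (maxn n1 n2) => n; rewrite geq_max => /andP[/wn1[x Sx xw] /wn2 wf].
exists (- (inner x f / inner x0 f) *: x0 + x).
  split; first exact: linS.
  by rewrite innerDl innerZl mulNr divfK // addNr.
rewrite -addrA; apply: le_lt_trans (nrm_triangle _ _) _.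
have xf : re `|inner x f| < e1 * (nrm f + 1).
  rewrite -(subrK (w n) x) innerDl; apply: le_lt_trans (re_normD _ _) _.
  rewrite mulrDr mulr1 ler_ltD //.
  apply: le_trans (cauchy_schwarz_re _ _) _.
  by rewrite ler_wpM2r ?nrm_ge0 // ltW.
have -> : e = e1 + e1 * (nrm f + 1) * c.
  by rewrite -mulrA -[X in X + _]mulr1 -mulrDr divfK // gt_eqF.
rewrite [ltRHS]addrC ler_ltD //.
by rewrite nrmZ_norm normrN re_normM -mulrA -/c ler_wpM2r // ltW.
Qed.

Lemma asymptotically_in_perp L (f : seq H) : closed_subspace L ->
  asymptotically_in L ->
  asymptotically_in [set x | L x /\ forall y, y \in f -> inner x y = 0].
Proof.
move=> cL wL; elim: f => [|y f IH].
  by move=> e /wL[n0 wn0]; exists n0 => n /wn0[x Lx xw]; exists x.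
have lin : forall a u v, L u /\ (forall z, z \in f -> inner u z = 0) ->
    L v /\ (forall z, z \in f -> inner v z = 0) ->
    L (a *: u + v) /\ (forall z, z \in f -> inner (a *: u + v) z = 0).
  move=> a u v [Lu uf] [Lv vf]; split; first exact: subspaceZD.
  by move=> z zf; rewrite innerDl innerZl uf // vf // mulr0 addr0.
move=> e /(@asymptotically_in_kernel _ y lin IH)[n0 wn0].
exists n0 => n /wn0[x [[Lx xf] xy] xw]; exists x => //; split=> // z.
by rewrite in_cons => /predU1P[->//|/xf].
Qed.

Hypothesis w_normalized : forall n, `|w n| = 1.

Lemma nrm_w n : nrm (w n) = 1.
Proof. by rewrite /nrm w_normalized -(rmorph1 of_real) of_realK. Qed.

Variables (K : nat) (L : 'I_K -> set H).
Hypothesis L_closed : forall k, closed_subspace (L k).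
Hypothesis wL : forall k, asymptotically_in (L k).

(** One term of the sequence w serves all k at once, and normalizing at most
    doubles the distance to it. *)
Lemma cluster (f : seq H) (e : R) : 0 < e -> exists v : 'I_K -> H,
  [/\ forall k, L k (v k), forall k, nrm (v k) = 1,
      forall k y, y \in f -> inner (v k) y = 0 &
      forall k l, nrm (v k - v l) <= e].
Proof.
move=> e0; pose d := Num.min (e / 4) 2^-1.
have d0 : 0 < d by rewrite lt_min; apply/andP; split; lra.
have /choice[n0 wn0] k := asymptotically_in_perp f (L_closed k) (wL k) d0.
pose n := \max_k n0 k.
have /choice[x xP] k : exists x, [/\ L k x, forall y, y \in f -> inner x y = 0
    & nrm (x - w n) < d].
  by have [|x [Lx xf] xw] := wn0 k n; [exact: leq_bigmax|exists x].
have x1 k : `|nrm (x k) - 1| < d.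
  have [_ _ xw] := xP k; rewrite -(nrm_w n) ltr_norml.
  have := nrm_triangle (x k - w n) (w n).
  have := nrm_triangle (w n - x k) (x k).
  by rewrite !subrK (nrmC (w n)) => *; apply/andP; split; lra.
have d2 : d <= 2^-1 by rewrite ge_min lexx orbT.
have d4 : d <= e / 4 by rewrite ge_min lexx.
have xn0 k : 0 < nrm (x k).
  by have := x1 k; rewrite ltr_norml => /andP[? ?]; lra.
pose v k := of_real (nrm (x k))^-1 *: x k.
have vx k : nrm (v k - x k) < d.
  rewrite /v -[X in _ - X]scale1r -(rmorph1 of_real) -scalerBl -rmorphB nrmZ.
  rewrite -[X in _ * X]gtr0_norm // -normrM mulrBl mulVf ?gt_eqF // mul1r.
  by rewrite distrC.
exists v; split=> [k|k|k y yf|k l].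
- by apply: subspaceZ => //; have [] := xP k.
- by rewrite nrmZ gtr0_norm ?invr_gt0 // mulVf ?gt_eqF.
- by rewrite innerZl; have [_ -> //] := xP k; rewrite mulr0.
- have [_ _ xk] := xP k; have [_ _ xl] := xP l.
  have := nrm_dist (x k) (v k) (v l); have := nrm_dist (w n) (x k) (v l).
  have := nrm_dist (x l) (w n) (v l); have := vx k; have := vx l.
  by rewrite (nrmC (x l)) (nrmC (w n) (x l)) => *; lra.
Qed.

(** The clusters are chosen one after the other along an enumeration of T, each
    of them orthogonal to all vectors chosen before. *)
Lemma orthogonal_clusters (T : countType) (eta : T -> R) :
  (forall t, 0 < eta t) -> exists v : T -> 'I_K -> H,
  [/\ forall t k, L k (v t k), forall t k, nrm (v t k) = 1,
      forall t u k l, t != u -> inner (v t k) (v u l) = 0 &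
      forall t k l, nrm (v t k - v t l) <= eta t].
Proof.
move=> eta0; pose tol j := if unpickle j is Some t then eta t else 1.
have tol0 j : 0 < tol j by rewrite /tol; case: unpickle.
have /choice[next nextP] (fj : seq H * nat) := cluster fj.1 (tol0 fj.2).
pose fix past j := if j is i.+1 then
  [seq next (past i, i) k | k <- enum 'I_K] ++ past i else [::].
have past_mem i j k : (i < j)%N -> next (past i, i) k \in past j.
  elim: j => // j IH; rewrite ltnS leq_eqVlt mem_cat.
  case/predU1P=> [->|/IH ->]; last exact: orbT.
  by rewrite map_f // mem_enum.
pose v (t : T) := next (past (pickle t), pickle t).
have v_perp t u k l : (pickle t < pickle u)%N -> inner (v t k) (v u l) = 0.
  move=> tu; have [_ _ u_perp _] := nextP (past (pickle u), pickle u).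
  exact/inner_eq0C/u_perp/past_mem.
exists v; split=> [t k|t k|t u k l tu|t k l].
- by have [+ _ _ _] := nextP (past (pickle t), pickle t); apply.
- by have [_ + _ _] := nextP (past (pickle t), pickle t); apply.
- case: (ltngtP (pickle t) (pickle u)) => [|ut|/(pcan_inj pickleK)/eqP].
  + exact: v_perp.
  + exact/inner_eq0C/v_perp.
  + by rewrite (negPf tu).
- have [_ _ _] := nextP (past (pickle t), pickle t).
  by move=> /(_ k l); rewrite /tol /= pickleK.
Qed.

End Atoms.

Lemma dist_max_asymptotically_in (R : realType) (s : scalars)
    (H : hilbertType R s) (w : nat -> H) K (L : 'I_K -> set H) :
  (forall k, closed_subspace (L k)) ->
  \big[Num.max/0]_(k < K) dist_to (w n) (L k) @[n --> \oo] --> (0 : R) ->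
  forall k, asymptotically_in w (L k).
Proof.
move=> cL /cvgrPdist_lt wL k e /wL[n0 _ wn0]; exists n0 => n /wn0 /=.
rewrite sub0r normrN => we; have [||x Lx xw] := @dist_to_lt _ _ _ (L k) (w n) e.
- by exists 0; exact: subspace0.
- apply: le_lt_trans we; apply: le_trans (ler_norm _).
  exact: (le_bigmax _ (fun k => dist_to (w n) (L k))).
- by exists x => //; rewrite nrmC.
Qed.

(** * Weights, scales and angles *)

Section Constants.
Context {R : realType}.
Implicit Types (b m l : nat -> R) (r : nat -> nat) (e x : R) (k n : nat).

Lemma exprn_small x e : 0 <= x -> x < 1 -> 0 < e -> exists n, x ^+ n <= e.
Proof.
move=> x0 x1 e0; have : `|x| < 1 by rewrite ger0_norm.
move=> /cvg_expr/cvgrPdist_le/(_ _ e0)[n _ /(_ n (leqnn n))] /=.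
rewrite sub0r normrN => xn; exists n; exact: le_trans (ler_norm _) xn.
Qed.

(** Bernoulli's inequality, read as: if x is within d of 1, then its n-th power
    is within n d of 1. *)
Lemma exprn_ge x n : 0 <= x -> x <= 1 -> 1 - x ^+ n <= n%:R * (1 - x).
Proof.
move=> x0 x1; elim: n => [|n IH]; first by rewrite expr0 subrr mul0r.
have xn1 : x ^+ n <= 1 by exact: exprn_ile1.
rewrite exprS -natr1; nra.
Qed.

(** The weights are chosen from the last one down: once b_j and r_j are known,
    the total of all earlier weights is made small compared with 1 / r_j.
    The induction therefore needs the bound c to be arbitrary. *)
Lemma geometric_weights (t : R) k c : 0 < t -> 0 < c -> c <= 1 ->
  exists b r, [/\ forall j, (j < k)%N -> 0 < b j, \sum_(j < k) b j <= c &
    forall j, (j < k)%N ->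
      (1 - b j) ^+ r j <= t /\ (r j)%:R * \sum_(i < j) b i <= t].
Proof.
move=> t0; elim: k c => [|k IH] c c0 c1.
  by exists (fun=> 0), (fun=> 0%N); split=> //; rewrite big_ord0 ltW.
have [||n n_small] := @exprn_small (1 - c / 2) t _ _ t0; [lra|lra|].
have n1 : 0 < n.+1%:R :> R by rewrite ltr0n.
have [||b [r [b0 bc brt]]] := IH (Num.min (c / 2) (t / n.+1%:R)).
- by rewrite lt_min; apply/andP; split; [lra|rewrite divr_gt0].
- by rewrite ge_min; apply/orP; left; lra.
move: bc; rewrite le_min => /andP[bc bt].
pose b' j := if (j < k)%N then b j else c / 2.
pose r' j := if (j < k)%N then r j else n.
have sum_b' j : (j <= k)%N -> \sum_(i < j) b' i = \sum_(i < j) b i.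
  by move=> jk; apply: eq_bigr => i _; rewrite /b' (leq_trans (ltn_ord i)).
exists b', r'; split=> [j _||j].
- by rewrite /b'; case: ifP => [/b0//|_]; lra.
- by rewrite big_ord_recr /= sum_b' // /b' ltnn; lra.
- rewrite ltnS leq_eqVlt => /predU1P[->|jk]; last first.
    by rewrite sum_b' ?(ltnW jk) // /b' /r' jk; exact: brt.
  rewrite sum_b' // /b' /r' ltnn; split=> //.
  have s0 : 0 <= \sum_(i < k) b i by apply: sumr_ge0 => i _; exact/ltW/b0.
  move: bt; rewrite ler_pdivlMr // -natr1; nra.
Qed.

(** The eigenvalue of P_A P_B P_A at a unit vector of A that B contains only
    after a tilt of slope x. *)
Definition damping (x : R) : R := (1 + x ^+ 2)^-1.

Lemma damping_gt0 x : 0 < damping x.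
Proof. by rewrite invr_gt0; nra. Qed.

Lemma damping_le1 x : damping x <= 1.
Proof. by rewrite invf_le1; nra. Qed.

Lemma damping_lt1 x : 0 < x -> damping x < 1.
Proof. by move=> x0; rewrite invf_lt1; nra. Qed.

Lemma damping0 : damping 0 = 1.
Proof. by rewrite /damping expr0n addr0 invr1. Qed.

Lemma damping_mul x : damping x * (1 + x ^+ 2) = 1.
Proof. by rewrite mulVf // gt_eqF //; nra. Qed.

Lemma damping_ge x : 0 <= x -> x <= 1 -> 1 - damping x <= x.
Proof.
move=> x0 x1; have := damping_mul x; have := damping_gt0 x.
have := damping_le1 x; move: (damping x) => d d1 d0; nra.
Qed.

(** The tilts are chosen from the first one up: a new tilt is so small that its
    damping factor survives all earlier exponents, and then its own exponent is
    large enough to kill everything so far. *)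
Lemma separated_scales (e d : R) k : 0 < e -> 0 < d -> exists m r,
  forall j, (j < k)%N -> [/\ 0 <= m j, m j <= d, damping (m j) ^+ r j <= e &
    forall i, (j < i < k)%N -> 1 - damping (m i) ^+ r j <= e].
Proof.
move=> e0 d0; elim: k => [|k [m [r mr]]].
  by exists (fun=> 0), (fun=> 0%N).
pose S := (\sum_(j < k) r j)%N.
have S1 : 0 < S.+1%:R :> R by rewrite ltr0n.
pose x := Num.min (Num.min d 1) (e / S.+1%:R).
have x0 : 0 < x by rewrite !lt_min d0 ltr01 divr_gt0.
have xd : x <= d by rewrite !ge_min lexx.
have x1 : x <= 1 by rewrite !ge_min lexx orbT.
have xS : S.+1%:R * x <= e.
  by rewrite mulrC -ler_pdivlMr // ge_min lexx orbT.
have [n n_small] := exprn_small (ltW (damping_gt0 x)) (damping_lt1 x0) e0.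
exists (fun j => if (j < k)%N then m j else x).
exists (fun j => if (j < k)%N then r j else n) => j.
rewrite ltnS leq_eqVlt => /predU1P[->|jk].
  rewrite ltnn; split=> [||//|i]; [exact: ltW|exact: xd|].
  by rewrite ltnS ltnNge => /andP[/negbTE ->].
rewrite jk; have [m0 md mre mij] := mr j jk; split=> // i /andP[ji _].
case: ifP => ik; first by apply: mij; rewrite ji.
apply: le_trans xS; apply: le_trans (exprn_ge _ _ _) _.
- exact/ltW/damping_gt0.
- exact: damping_le1.
apply: ler_pM; rewrite ?ler0n ?subr_ge0 ?damping_le1 //.
  by rewrite ler_nat (leq_trans _ (leqnSn S)) // /S (bigD1 (Ordinal jk)) //= leq_addr.
by apply: damping_ge => //; exact: ltW.
Qed.

Lemma sin_le x : 0 <= x -> sin x <= x.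
Proof.
rewrite le_eqVlt => /predU1P[<-|x0]; first by rewrite sin0.
have [c _] := MVT x0 (fun c _ => is_derive_sin c)
  (continuous_subspaceT (@continuous_sin R)).
rewrite sin0 !subr0 => ->; rewrite -[leRHS]mul1r.
by rewrite ler_wpM2r ?cos_le1 // ltW.
Qed.

(** 1 - c is at most 1 - c^2, the square of the sine, when c lies between 0
    and 1. *)
Lemma cos_ge x : 0 <= x -> x <= pi / 2 -> 1 - cos x <= x ^+ 2.
Proof.
move=> x0 xpi; have p1 := @pihalf_ge1 R.
have c0 : 0 <= cos x by apply: cos_ge0_pihalf; apply/andP; split=> //; lra.
have c1 := cos_le1 x; have := cos2Dsin2 x.
have s0 : 0 <= sin x by apply: sin_ge0_pi; apply/andP; split=> //; nra.
have sx := sin_le x0; nra.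
Qed.

Definition angle k : R := pi / 2 / k%:R.

(** k steps of angle of order 1/k, each losing a fraction of order 1/k^2. *)
Lemma fine_rotation e : 0 < e ->
  exists2 k, (0 < k)%N & 0 <= cos (angle k) /\ 1 - cos (angle k) ^+ k <= e.
Proof.
move=> e0; have [k ke] := ltr_add_invr (divr_gt0 e0 (ltr0n R 4)).
exists k.+1 => //; set c := cos _.
have p2 := @pihalf_lt2 R; have p1 := @pihalf_ge1 R.
have k1 : 1 <= k.+1%:R :> R by rewrite ler1n.
have a0 : 0 <= angle k.+1 by rewrite divr_ge0 ?ler0n //; lra.
have ak : angle k.+1 * k.+1%:R = pi / 2 by rewrite divfK // gt_eqF //; lra.
have api : angle k.+1 <= pi / 2 by nra.
have c0 : 0 <= c by apply: cos_ge0_pihalf; apply/andP; split=> //; lra.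
split=> //; apply: le_trans (exprn_ge _ c0 (cos_le1 _)) _.
have cx := cos_ge a0 api; rewrite -/c in cx.
have kc : k.+1%:R * (1 - c) <= angle k.+1 * (pi / 2) by rewrite -ak; nra.
apply: le_trans kc _.
have ai : angle k.+1 = pi / 2 * k.+1%:R^-1 by [].
have i0 : 0 < k.+1%:R^-1 :> R by rewrite invr_gt0; lra.
rewrite ai; move: ke i0; rewrite add0r.
move: (k.+1%:R^-1 : R) (pi / 2) p1 p2 => i p p1 p2 ie i0.
have pp : p * p <= 4 by nra.
have ipp : i * (p * p) <= i * 4 by rewrite ler_wpM2l // ltW.
have -> : p * i * p = i * (p * p) by ring.
lra.
Qed.

End Constants.

(** * A tight frame of the plane *)

Section Plan.
Context {R : realType}.

(** Collects what a stage fixes before the other stages are known. The number om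
    bounds both the distance from e_n and e_(n+1) to the subspaces and the
    imperfection of the powers of the damping factors; the left-hand side of the
    last inequality is the error that they cause in a whole stage: K leading
    projections, then r_j steps on the j-th line, then the loss of length. *)
Lemma rotation_plan (K : nat) (e : R) : 0 < e ->
  exists k (b : nat -> R) (r : nat -> nat) (om : R),
  [/\ [/\ (0 < k)%N, 0 < om & 0 <= cos (angle k : R)],
      forall j, (j < k)%N -> 0 < b j, \sum_(j < k) b j <= 1 &
      K%:R * om + \sum_(j < k) ((r j)%:R * (8 * om + 4 * \sum_(i < j) b i)
                                + 2 * (1 - b j) ^+ r j)
        + (1 - cos (angle k) ^+ k) <= e].
Proof.
move=> e0; have e2 : 0 < e / 2 by lra.
have [k k0 [ck ke]] := fine_rotation e2.
have k1 : 0 < k%:R :> R by rewrite ltr0n.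
(* each of the k lines contributes 4 t + 2 t, in total a quarter of e *)
pose t := e / (24 * k%:R); have t0 : 0 < t by rewrite divr_gt0 // mulr_gt0.
have [b [r [b0 b1 br]]] := geometric_weights k t0 ltr01 (lexx 1).
pose N := (\sum_(j < k) r j)%N.
have N0 : 0 <= N%:R :> R by rewrite ler0n.
have K0 : 0 <= K%:R :> R by rewrite ler0n.
(* the terms with om contribute another quarter of e *)
pose om := e / (4 * (K%:R + 8 * N%:R + 1)).
have om0 : 0 < om by rewrite divr_gt0 //; lra.
exists k, b, r, om; split=> //.
have omE : om * (K%:R + 8 * N%:R + 1) = e / 4.
  by rewrite /om; field; lra.
have tE : t * k%:R = e / 24 by rewrite /t; field; rewrite gt_eqF.
have : \sum_(j < k) ((r j)%:R * (8 * om + 4 * \sum_(i < j) b i)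
    + 2 * (1 - b j) ^+ r j) <= \sum_(j < k) ((r j)%:R * (8 * om) + 6 * t).
  apply: ler_sum => j _; have [bt rt] := br j (ltn_ord j).
  by move: (\sum_(i < j) b i) rt => x rt; lra.
rewrite [leRHS]big_split /= -mulr_suml -natr_sum -/N sumr_const card_ord.
rewrite -mulr_natr; move: (\sum_(j < k) _) => x xN.
by nra.
Qed.

Section Frame.
Variables (k : nat) (b g1 g2 : nat -> R).
Hypothesis b_ge0 : forall i, (i < k)%N -> 0 <= b i.
Hypothesis b_sum : \sum_(i < k) b i <= 1.
Hypothesis g_unit : forall i, g1 i ^+ 2 + g2 i ^+ 2 = 1.

(** The vectors (frame1 i, frame2 i) form a tight frame of the plane: an even
    index 2i carries the prescribed vector sqrt (b i) g_i, the next odd index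
    the same vector turned by a right angle, so that both together contribute
    b i times the identity, and the last two indices supply the missing
    multiple of the identity. *)
Definition frame1 i : R :=
  if (i < k.*2)%N then
    Num.sqrt (b i./2) * (if odd i then - g2 i./2 else g1 i./2)
  else if i == k.*2 then Num.sqrt (1 - \sum_(i < k) b i) else 0.

Definition frame2 i : R :=
  if (i < k.*2)%N then
    Num.sqrt (b i./2) * (if odd i then g1 i./2 else g2 i./2)
  else if i == k.*2 then 0 else Num.sqrt (1 - \sum_(i < k) b i).

Lemma sum_double (f : nat -> R) n :
  \sum_(i < n.*2) f i = \sum_(i < n) (f i.*2 + f i.*2.+1).
Proof.
elim: n => [|n IH]; first by rewrite !big_ord0.
by rewrite doubleS !big_ord_recr /= IH addrA.
Qed.

Lemma frame_even i : (i < k)%N ->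
  (frame1 i.*2 = Num.sqrt (b i) * g1 i) * (frame2 i.*2 = Num.sqrt (b i) * g2 i).
Proof.
by move=> ik; rewrite /frame1 /frame2 ltn_double ik odd_double doubleK.
Qed.

Lemma frame_odd i : (i < k)%N ->
  (frame1 i.*2.+1 = Num.sqrt (b i) * - g2 i) *
  (frame2 i.*2.+1 = Num.sqrt (b i) * g1 i).
Proof.
move=> ik; rewrite /frame1 /frame2 ltn_Sdouble ik /= odd_double /=.
by rewrite uphalf_double.
Qed.

(** The sum over the frame of W i p_i p_i^T, for weights that differ from 1 only
    at the prescribed vectors: it is the identity minus what these weights take
    away. With W = 1 this is tightness, and with powers of damping factors it
    is the compression of a power of P_A P_B to the plane. *)
Lemma frame_sum (W : nat -> R) x y :
  (forall i, (i < k)%N -> W i.*2.+1 = 1) -> W k.*2 = 1 -> W k.*2.+1 = 1 ->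
  (\sum_(i < k.*2.+2) W i * (x * frame1 i + y * frame2 i) * frame1 i =
     x - \sum_(i < k) (1 - W i.*2) * (b i * (x * g1 i + y * g2 i)) * g1 i) *
  (\sum_(i < k.*2.+2) W i * (x * frame1 i + y * frame2 i) * frame2 i =
     y - \sum_(i < k) (1 - W i.*2) * (b i * (x * g1 i + y * g2 i)) * g2 i).
Proof.
move=> Wo W1 W2; have c0 : 0 <= 1 - \sum_(i < k) b i by rewrite subr_ge0.
have sc := sqr_sqrtr c0.
have pos i : (i < k)%N -> exists2 q, Num.sqrt (b i) = q & b i = q ^+ 2.
  by move=> ik; exists (Num.sqrt (b i)) => //; rewrite sqr_sqrtr ?b_ge0.
have last1 : (frame1 k.*2 = Num.sqrt (1 - \sum_(i < k) b i))
    * (frame2 k.*2 = 0) * (frame1 k.*2.+1 = 0)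
    * (frame2 k.*2.+1 = Num.sqrt (1 - \sum_(i < k) b i)).
  by rewrite /frame1 /frame2 ltnn eqxx ltnNge leqnSn /= gtn_eqF.
split; [pose f i := W i * (x * frame1 i + y * frame2 i) * frame1 i
       |pose f i := W i * (x * frame1 i + y * frame2 i) * frame2 i];
  rewrite -[LHS]/(\sum_(i < k.*2.+2) f i) !big_ord_recr /= sum_double /f;
  rewrite !last1 W1 W2 !mul1r !mulr0 !addr0 ?add0r -mulrA -expr2 sc.
- transitivity (\sum_(i < k) (x * b i
      - (1 - W i.*2) * (b i * (x * g1 i + y * g2 i)) * g1 i)
      + x * (1 - \sum_(i < k) b i)).
    congr (_ + _); apply: eq_bigr => i _; have ik := ltn_ord i.
    rewrite !(frame_even ik) !(frame_odd ik) Wo //.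
    have [q -> ->] := pos i ik; have := g_unit i.
    move: (g1 i) (g2 i) (W _) => a c w ac; apply/subr0_eq.
    transitivity (x * q ^+ 2 * (a ^+ 2 + c ^+ 2 - 1)); first by ring.
    by rewrite ac subrr mulr0.
  by rewrite sumrB -mulr_sumr; ring.
- transitivity (\sum_(i < k) (y * b i
      - (1 - W i.*2) * (b i * (x * g1 i + y * g2 i)) * g2 i)
      + y * (1 - \sum_(i < k) b i)).
    congr (_ + _); apply: eq_bigr => i _; have ik := ltn_ord i.
    rewrite !(frame_even ik) !(frame_odd ik) Wo //.
    have [q -> ->] := pos i ik; have := g_unit i.
    move: (g1 i) (g2 i) (W _) => a c w ac; apply/subr0_eq.
    transitivity (y * q ^+ 2 * (a ^+ 2 + c ^+ 2 - 1)); first by ring.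
    by rewrite ac subrr mulr0.
  by rewrite sumrB -mulr_sumr; ring.
Qed.

Lemma frame_tight :
  [/\ \sum_(i < k.*2.+2) frame1 i ^+ 2 = 1, \sum_(i < k.*2.+2) frame2 i ^+ 2 = 1 &
      \sum_(i < k.*2.+2) frame1 i * frame2 i = 0].
Proof.
have tight x y := @frame_sum (fun=> 1) x y (fun _ _ => erefl) erefl erefl.
have zero g : \sum_(i < k) (1 - 1) * (b i * g i) * g1 i = 0 :> R.
  by apply: big1 => i _; rewrite subrr !mul0r.
have zero' g : \sum_(i < k) (1 - 1) * (b i * g i) * g2 i = 0 :> R.
  by apply: big1 => i _; rewrite subrr !mul0r.
have [t1 t2] := tight 1 0; have [_ t3] := tight 0 1.
rewrite zero subr0 in t1; rewrite zero' subrr in t2; rewrite zero' subr0 in t3.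
split; [rewrite -[RHS]t1|rewrite -[RHS]t3|rewrite -[RHS]t2];
  by apply: eq_bigr => i _; ring.
Qed.

End Frame.

End Plan.

(** * Eigenvectors and their tilts *)

(** The indices of the clusters. In block n, the axes n and n+1 are the vectors
    e_n and e_(n+1), the core vectors enlarge the plane of the axes to a
    space that has room for the eigenvectors, and the extra vectors are the
    directions of the tilts. *)
Definition atom : Type := (nat * (unit + nat * bool))%type.
Definition axis n : atom := (n, inl tt).
Definition core n i : atom := (n, inr (i, true)).
Definition extra n i : atom := (n, inr (i, false)).
Definition is_extra (t : atom) : bool :=
  if t.2 is inr (_, false) then true else false.
Definition block n : pred atom :=
  fun t => (t.1 == n) || (t == axis n.+1).

Section Blocks.
Context {R : realType} {s : scalars} {H : hilbertType R s} {K : nat}.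
Local Notation of_real := (@of_real R s).
Variable v : atom -> 'I_K -> H.
Hypothesis v_unit : forall t k, nrm (v t k) = 1.
Hypothesis v_perp : forall t u k l, t != u -> inner (v t k) (v u l) = 0.
Variables (M : nat -> nat) (p1 p2 mu : nat -> nat -> R).
Hypothesis p11 : forall n, \sum_(i < M n) p1 n i ^+ 2 = 1.
Hypothesis p22 : forall n, \sum_(i < M n) p2 n i ^+ 2 = 1.
Hypothesis p12 : forall n, \sum_(i < M n) p1 n i * p2 n i = 0.

Lemma inner_v t u k : inner (v t k) (v u k) = (t == u)%:R.
Proof.
have [<-|tu] := eqVneq t u; last exact: v_perp.
by rewrite inner_normE nrmE v_unit rmorph1 expr1n.
Qed.

Definition shift1 n k : H :=
  v (axis n) k - \sum_(j < M n) of_real (p1 n j) *: v (core n j) k.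
Definition shift2 n k : H :=
  v (axis n.+1) k - \sum_(j < M n) of_real (p2 n j) *: v (core n j) k.

(** The vector c := sum_j p1_j core_j is a unit vector, and so is its analogue
    for p2; they are orthogonal since the frame is tight. Exchanging them with
    the two axes and keeping everything orthogonal to these four vectors is a
    reflection, and eigvec n i is the image of core i. So the eigenvectors are
    orthonormal, and eigvec n i projects to the plane of the axes as the i-th
    vector of the frame. *)
Definition eigvec n i k : H := v (core n i) k
  + of_real (p1 n i) *: shift1 n k + of_real (p2 n i) *: shift2 n k.
Definition tilted n i k : H :=
  eigvec n i k + of_real (mu n i) *: v (extra n i) k.

Lemma inner_rZl r (x y : H) : inner (of_real r *: x) y = of_real r * inner x y.
Proof. exact: innerZl. Qed.

Lemma inner_rZr r (x y : H) : inner x (of_real r *: y) = of_real r * inner x y.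
Proof. by rewrite innerZr conj_of_real. Qed.

Lemma core_combo_axis n (p : nat -> R) m k :
  inner (\sum_(j < M n) of_real (p j) *: v (core n j) k) (v (axis m) k) = 0.
Proof.
rewrite inner_suml big1 // => j _; rewrite inner_rZl v_perp ?mulr0 //.
by apply/eqP => -[].
Qed.

Lemma core_combo_core n (p : nat -> R) i k : (i < M n)%N ->
  inner (\sum_(j < M n) of_real (p j) *: v (core n j) k) (v (core n i) k)
    = of_real (p i).
Proof.
move=> iM; rewrite inner_suml (bigD1 (Ordinal iM)) //= inner_rZl inner_v eqxx.
rewrite mulr1 big1 ?addr0 // => j ij; rewrite inner_rZl inner_v.
rewrite (_ : (_ == _) = false) ?mulr0 //; apply: contra_neqF ij => /eqP[ij].
exact: val_inj.
Qed.

Lemma core_combo_combo n (p q : nat -> R) k :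
  inner (\sum_(j < M n) of_real (p j) *: v (core n j) k)
        (\sum_(j < M n) of_real (q j) *: v (core n j) k)
    = of_real (\sum_(j < M n) p j * q j).
Proof.
rewrite inner_sumr rmorph_sum; apply: eq_bigr => i _.
by rewrite inner_rZr core_combo_core // rmorphM mulrC.
Qed.

Lemma inner_shift n k :
  [/\ inner (shift1 n k) (shift1 n k) = 2, inner (shift2 n k) (shift2 n k) = 2,
      inner (shift1 n k) (shift2 n k) = 0 &
      inner (shift2 n k) (shift1 n k) = 0].
Proof.
have axis_combo (p : nat -> R) m : inner (v (axis m) k)
   (\sum_(j < M n) of_real (p j) *: v (core n j) k) = 0.
  exact/inner_eq0C/core_combo_axis.
have s12 : inner (shift1 n k) (shift2 n k) = 0.
  rewrite !(innerBl, innerBr) inner_v axis_combo core_combo_axis.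
  rewrite core_combo_combo p12 rmorph0 !subr0 /axis.
  by rewrite (_ : (_ == _) = false) //; apply/eqP => -[/n_Sn].
split=> //; last exact: inner_eq0C.
  rewrite !(innerBl, innerBr) inner_v eqxx axis_combo core_combo_axis.
  rewrite core_combo_combo (eq_bigr (fun j : 'I__ => p1 n j ^+ 2)) // p11.
  by rewrite rmorph1; ring.
rewrite !(innerBl, innerBr) inner_v eqxx axis_combo core_combo_axis.
rewrite core_combo_combo (eq_bigr (fun j : 'I__ => p2 n j ^+ 2)) // p22.
by rewrite rmorph1; ring.
Qed.

Lemma inner_shift_core n i k : (i < M n)%N ->
  [/\ inner (shift1 n k) (v (core n i) k) = - of_real (p1 n i),
      inner (shift2 n k) (v (core n i) k) = - of_real (p2 n i),
      inner (v (core n i) k) (shift1 n k) = - of_real (p1 n i) &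
      inner (v (core n i) k) (shift2 n k) = - of_real (p2 n i)].
Proof.
move=> iM.
have h1 : inner (shift1 n k) (v (core n i) k) = - of_real (p1 n i).
  rewrite innerBl v_perp ?core_combo_core ?sub0r //; by apply/eqP => -[].
have h2 : inner (shift2 n k) (v (core n i) k) = - of_real (p2 n i).
  rewrite innerBl v_perp ?core_combo_core ?sub0r //; by apply/eqP => -[].
by split=> //; rewrite innerC ?h1 ?h2 -rmorphN conj_of_real.
Qed.

(** The reflection behind the definition is an isometry. *)
Lemma inner_eigvec n i j k : (i < M n)%N -> (j < M n)%N ->
  inner (eigvec n i k) (eigvec n j k) = (i == j)%:R.
Proof.
move=> iM jM; have [s11 s22 s12 s21] := inner_shift n k.
have [a1 a2 _ _] := inner_shift_core k jM.
have [_ _ c1 c2] := inner_shift_core k iM.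
have := inner_v (core n i) (core n j) k.
have -> : (core n i == core n j) = (i == j).
  by apply/eqP/eqP => [[]|->].
rewrite /eigvec; move: (shift1 n k) (shift2 n k) (v _ k) (v _ k)
  s11 s22 s12 s21 a1 a2 c1 c2 => d1 d2 u w s11 s22 s12 s21 a1 a2 c1 c2 uw.
rewrite !(innerDl, innerDr, inner_rZl, inner_rZr) s11 s22 s12 s21 a1 a2 c1 c2 uw.
ring.
Qed.

Lemma eigvec_perp n i k z : (i < M n)%N ->
  (forall t, block n t -> inner (v t k) z = 0) -> inner (eigvec n i k) z = 0.
Proof.
move=> iM z_perp.
have core0 j : inner (v (core n j) k) z = 0 by apply: z_perp; rewrite /block eqxx.
have combo0 (p : nat -> R) :
    inner (\sum_(j < M n) of_real (p j) *: v (core n j) k) z = 0.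
  by rewrite inner_suml big1 // => j _; rewrite inner_rZl core0 mulr0.
rewrite /eigvec !innerDl !inner_rZl !innerBl core0 !combo0.
by rewrite !z_perp ?subr0 ?mulr0 ?addr0 // /block /= eqxx ?orbT.
Qed.

Lemma tilted_perp n i k z : (i < M n)%N ->
  (forall t, block n t -> inner (v t k) z = 0) -> inner (tilted n i k) z = 0.
Proof.
move=> iM z_perp; rewrite innerDl eigvec_perp // inner_rZl z_perp.
  by rewrite mulr0 addr0.
by rewrite /block eqxx.
Qed.

Lemma v_tilted t l n i k : (i < M n)%N -> ~~ block n t ->
  inner (v t l) (tilted n i k) = 0.
Proof.
move=> iM nt; apply: inner_eq0C; apply: tilted_perp => // u nu; apply: v_perp.
by apply: contraNneq nt => <-.
Qed.

Lemma eigvec_extra n i k j : (i < M n)%N ->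
  inner (eigvec n i k) (v (extra n j) k) = 0.
Proof.
move=> iM.
have ext u : ~~ is_extra u -> inner (v u k) (v (extra n j) k) = 0.
  by move=> eu; apply: v_perp; apply: contraNneq eu => ->.
have combo0 (p : nat -> R) : inner (\sum_(j < M n) of_real (p j) *: v (core n j) k)
    (v (extra n j) k) = 0.
  by rewrite inner_suml big1 // => m _; rewrite inner_rZl ext // mulr0.
rewrite /eigvec !innerDl !inner_rZl !innerBl !combo0 !ext //.
by rewrite subr0 !mulr0 !addr0.
Qed.

Lemma inner_eigvec_tilted n i j k : (i < M n)%N -> (j < M n)%N ->
  inner (eigvec n i k) (tilted n j k) = (i == j)%:R.
Proof.
move=> iM jM.
by rewrite innerDr inner_eigvec // inner_rZr eigvec_extra // mulr0 addr0.
Qed.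

Lemma inner_tilted n i j k : (i < M n)%N -> (j < M n)%N ->
  inner (tilted n i k) (tilted n j k) = (i == j)%:R * of_real (1 + mu n i ^+ 2).
Proof.
move=> iM jM; rewrite innerDl inner_eigvec_tilted // inner_rZl innerDr.
rewrite (inner_eq0C (eigvec_extra _ _ jM)) add0r inner_rZr inner_v.
have -> : (extra n i == extra n j) = (i == j) by apply/eqP/eqP => [[]|->].
have [->|ij] := eqVneq i j; last by rewrite !mulr0 mul0r addr0.
by rewrite mul1r rmorphD rmorph1 rmorphXn /=; ring.
Qed.

(** The reflection exchanges the axes with the combinations of the core vectors
    whose coordinates are p1 and p2. *)
Lemma eigvec_sum_axis n k :
  (v (axis n) k = \sum_(i < M n) of_real (p1 n i) *: eigvec n i k) *
  (v (axis n.+1) k = \sum_(i < M n) of_real (p2 n i) *: eigvec n i k).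
Proof.
have combo (p : nat -> R) : \sum_(i < M n) of_real (p i) *: eigvec n i k =
    \sum_(i < M n) of_real (p i) *: v (core n i) k
    + of_real (\sum_(i < M n) p1 n i * p i) *: shift1 n k
    + of_real (\sum_(i < M n) p2 n i * p i) *: shift2 n k.
  rewrite !rmorph_sum !scaler_suml -!big_split /=; apply: eq_bigr => i _.
  by rewrite /eigvec !scalerDr !scalerA -!rmorphM /= ![p i * _]mulrC.
split; rewrite combo.
  under [X in of_real X *: shift2 _ _]eq_bigr do rewrite mulrC.
  by rewrite p12 (eq_bigr (fun i : 'I__ => p1 n i ^+ 2)) // p11 rmorph0 rmorph1
    scale0r addr0 scale1r subrKC.
by rewrite p12 (eq_bigr (fun i : 'I__ => p2 n i ^+ 2)) // p22 rmorph0 rmorph1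
  scale0r addr0 scale1r subrKC.
Qed.

End Blocks.

(** * The subspaces and their projections *)

Section Spaces.
Context {R : realType} {s : scalars} {H : hilbertType R s} {K : nat}.
Local Notation of_real := (@of_real R s).
Variable v : atom -> 'I_K -> H.
Hypothesis v_unit : forall t k, nrm (v t k) = 1.
Hypothesis v_perp : forall t u k l, t != u -> inner (v t k) (v u l) = 0.
Variables (M : nat -> nat) (p1 p2 mu : nat -> nat -> R).
Hypothesis p11 : forall n, \sum_(i < M n) p1 n i ^+ 2 = 1.
Hypothesis p22 : forall n, \sum_(i < M n) p2 n i ^+ 2 = 1.
Hypothesis p12 : forall n, \sum_(i < M n) p1 n i * p2 n i = 0.
Local Notation eigvec := (eigvec v M p1 p2).
Local Notation tilted := (tilted v M p1 p2 mu).
Variables B C : 'I_K.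
Hypothesis BC : B != C.

Definition carrier (n : nat) : 'I_K := if odd n then C else B.

(** B and C contain the tilted vectors of every other block, and these blocks
    are orthogonal to each other because they share no axis. *)
Definition generators (k : 'I_K) : set H := [set x |
  (exists n i, [/\ carrier n = k, (i < M n)%N & x = tilted n i k]) \/
  [/\ k != B, k != C & exists2 t, ~~ is_extra t & x = v t k]].

Definition trimmed k : set H := perp (perp (generators k)).
Local Notation P k := (orth_proj (trimmed k)).

Lemma closed_trimmed k : closed_subspace (trimmed k).
Proof. exact: perp_closed_subspace. Qed.
Hint Resolve closed_trimmed : core.

Lemma carrier_inj m n : carrier m = carrier n -> odd m = odd n.
Proof.
rewrite /carrier; case: (odd m); case: (odd n) => // /eqP.
  by rewrite eq_sym (negPf BC).
by rewrite (negPf BC).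
Qed.

Lemma carrierBC n k : k != B -> k != C -> carrier n != k.
Proof.
by rewrite /carrier => kB kC; case: ifP; rewrite eq_sym.
Qed.

Lemma block_parity m n t : odd m = odd n -> m != n -> block n t -> ~~ block m t.
Proof.
move=> mn neq /orP[/eqP tn|/eqP ->]; rewrite /block negb_or.
  rewrite tn eq_sym neq; apply: contra_eqN mn => /eqP tm.
  by move: tn; rewrite tm /= => <- /=; case: (odd m).
apply/andP; split.
  by apply: contra_eqN mn => /eqP /= <- /=; case: (odd n).
by apply: contra_neqN neq => /eqP [].
Qed.

Lemma trimmed_tilted n i : (i < M n)%N ->
  trimmed (carrier n) (tilted n i (carrier n)).
Proof. by move=> iM; apply: sub_perpK; left; exists n, i. Qed.

Lemma trimmed_flat k t : k != B -> k != C -> ~~ is_extra t ->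
  trimmed k (v t k).
Proof. by move=> kB kC et; apply: sub_perpK; right; split=> //; exists t. Qed.

(** In the plane of eigvec n i and the tilt direction this is the projection
    onto a line of slope mu n i; all other generators are orthogonal to that
    plane. *)
Lemma proj_eigvec n i : (i < M n)%N ->
  P (carrier n) (eigvec n i (carrier n)) =
  of_real (damping (mu n i)) *: tilted n i (carrier n).
Proof.
move=> iM; apply: orth_proj_perpK.
  exact: (subspaceZ _ (closed_trimmed _) (trimmed_tilted iM)).
move=> y [[m [j [mn jM ->]]]|[nB nC _]]; last first.
  by have := carrierBC n nB nC; rewrite eqxx.
have [nm|neq] := eqVneq m n.
  move: jM; rewrite nm => jM; rewrite innerBl inner_rZl.
  rewrite inner_eigvec_tilted // inner_tilted // mulrCA -rmorphM damping_mul.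
  by rewrite rmorph1 mulr1 subrr.
have nperp t : block n t -> inner (v t (carrier n)) (tilted m j (carrier n)) = 0.
  move=> nt; apply: v_tilted => //; apply: block_parity nt => //.
  exact: carrier_inj.
by rewrite innerBl inner_rZl eigvec_perp // tilted_perp // mulr0 subrr.
Qed.

Section Flat.
Variables (A : 'I_K) (AB : A != B) (AC : A != C).

Lemma proj_extra n i : P A (v (extra n i) A) = 0.
Proof.
apply: orth_proj_perpK; first exact: subspace0 (closed_trimmed _).
rewrite subr0 => y [[m [j [mA _ _]]]|[_ _ [t et ->]]].
  by have := carrierBC m AB AC; rewrite mA eqxx.
by apply: v_perp; apply: contraNneq et => <-.
Qed.

Lemma proj_eigvec_flat n i : P A (eigvec n i A) = eigvec n i A.
Proof.
apply: orth_proj_id => //.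
have cL := closed_trimmed A.
have flat t : ~~ is_extra t -> trimmed A (v t A) by exact: trimmed_flat.
have comb (p : nat -> R) :
    trimmed A (\sum_(j < M n) of_real (p j) *: v (core n j) A).
  by apply: subspace_sum => // j _; exact/(subspaceZ _ cL)/flat.
apply: (subspaceD cL); first apply: (subspaceD cL); first exact: flat.
  by apply/(subspaceZ _ cL)/(subspaceB cL); [exact: flat|exact: comb].
by apply/(subspaceZ _ cL)/(subspaceB cL); [exact: flat|exact: comb].
Qed.

Lemma proj_tilted_flat n i : P A (tilted n i A) = eigvec n i A.
Proof.
by rewrite orth_projD // orth_projZ // proj_extra proj_eigvec_flat scaler0 addr0.
Qed.

End Flat.

(** Of block n, the other subspace only sees the axes. *)
Lemma proj_core_other n i l : P (carrier n.+1) (v (core n i) l) = 0.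
Proof.
apply: orth_proj_perpK; first exact: subspace0 (closed_trimmed _).
rewrite subr0 => y [[m [j [mn jM ->]]]|[nB nC _]]; last first.
  by have := carrierBC n.+1 nB nC; rewrite eqxx.
apply: v_tilted => //; rewrite negb_or; apply/andP; split; last first.
  by apply/eqP => -[].
apply: contra_eqN (carrier_inj mn) => /eqP /= -> /=.
by case: (odd m).
Qed.

Variable h : nat -> R.
Hypothesis h_close : forall n t k l, block n t -> nrm (v t k - v t l) <= h n.

Lemma frame_le1 n i : (i < M n)%N -> (`|p1 n i| <= 1) * (`|p2 n i| <= 1).
Proof.
move=> iM; split; rewrite -(@ler_pXn2r _ 2) ?nnegrE ?normr_ge0 //;
  rewrite expr1n real_normK ?num_real //.
- rewrite -(p11 n) (bigD1 (Ordinal iM)) //= lerDl.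
  by apply: sumr_ge0 => j _; exact: sqr_ge0.
- rewrite -(p22 n) (bigD1 (Ordinal iM)) //= lerDl.
  by apply: sumr_ge0 => j _; exact: sqr_ge0.
Qed.

Lemma h_ge0 n : 0 <= h n.
Proof. by rewrite -(@nrm0 R s H) -(subrr (v (axis n) B)) h_close // /block eqxx. Qed.

Lemma nrmZ_le1 (r x : R) (z : H) : `|r| <= 1 -> nrm z <= x ->
  nrm (of_real r *: z) <= x.
Proof.
move=> r1; apply: le_trans; rewrite nrmZ -[leRHS]mul1r.
by rewrite ler_wpM2r ?nrm_ge0.
Qed.

Lemma eigvec_close n i k l : (i < M n)%N ->
  nrm (eigvec n i k - eigvec n i l) <= (2 * (M n)%:R + 3) * h n.
Proof.
move=> iM; have [q1 q2] := frame_le1 iM.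
have combo (p : nat -> R) : (forall j, (j < M n)%N -> `|p j| <= 1) ->
    nrm (\sum_(j < M n) of_real (p j) *: v (core n j) k
         - \sum_(j < M n) of_real (p j) *: v (core n j) l) <= (M n)%:R * h n.
  move=> p_le; rewrite -sumrB; apply: le_trans (ler_nrm_sum _ _ _) _.
  rewrite mulr_natl -[X in _ *+ X](card_ord (M n)) -sumr_const.
  apply: ler_sum => j _; rewrite -scalerBr nrmZ_le1 ?p_le //.
  by rewrite h_close // /block eqxx.
rewrite /eigvec opprD addrACA opprD (addrACA (v _ k)) -!scalerBr.
have nrm_close m (p : nat -> R) : block n (axis m) ->
    (forall j, (j < M n)%N -> `|p j| <= 1) ->
    nrm (v (axis m) k - \sum_(j < M n) of_real (p j) *: v (core n j) k
      - (v (axis m) l - \sum_(j < M n) of_real (p j) *: v (core n j) l))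
    <= h n + (M n)%:R * h n.
  move=> nm p_le; rewrite opprD addrACA -opprD.
  apply: le_trans (nrm_triangle _ _) _; rewrite nrmN lerD ?combo //.
  exact: h_close.
have s1 : nrm (of_real (p1 n i) *: (shift1 v M p1 n k - shift1 v M p1 n l))
    <= h n + (M n)%:R * h n.
  apply: nrmZ_le1 => //; apply: nrm_close => [|j jM].
    by rewrite /block eqxx.
  by rewrite (frame_le1 jM).
have s2 : nrm (of_real (p2 n i) *: (shift2 v M p2 n k - shift2 v M p2 n l))
    <= h n + (M n)%:R * h n.
  apply: nrmZ_le1 => //; apply: nrm_close => [|j jM].
    by rewrite /block eqxx orbT.
  by rewrite (frame_le1 jM).
apply: le_trans (nrm_triangle _ _) _.
have := nrm_triangle (v (core n i) k - v (core n i) l)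
  (of_real (p1 n i) *: (shift1 v M p1 n k - shift1 v M p1 n l)).
have : nrm (v (core n i) k - v (core n i) l) <= h n.
  by rewrite h_close // /block eqxx.
by move=> *; lra.
Qed.

Hypothesis mu_le1 : forall n i, 0 <= mu n i <= 1.

Lemma tilted_close n i k l : (i < M n)%N ->
  nrm (tilted n i k - tilted n i l) <= (2 * (M n)%:R + 4) * h n.
Proof.
move=> iM; rewrite /tilted opprD addrACA -scalerBr.
apply: le_trans (nrm_triangle _ _) _.
have : nrm (of_real (mu n i) *: (v (extra n i) k - v (extra n i) l)) <= h n.
  have /andP[m0 m1] := mu_le1 n i.
  by rewrite nrmZ_le1 ?ger0_norm ?h_close // /block eqxx.
by have := eigvec_close k l iM => *; lra.
Qed.

Lemma damping_norm1 x : `|damping x : R| <= 1.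
Proof. by rewrite gtr0_norm ?damping_gt0 // damping_le1. Qed.

Section Stage.
Variables (A : 'I_K) (AB : A != B) (AC : A != C).

(** If the clusters were single vectors, P_A P_B would multiply the eigenvector
    by the damping factor exactly; one change from A to B, and one back from B
    to A, cost the distance between eigvec or tilted vectors in the two
    subspaces. *)
Lemma damp_eigvec n i : (i < M n)%N ->
  nrm (P A (P (carrier n) (eigvec n i A))
       - of_real (damping (mu n i)) *: eigvec n i A)
  <= (4 * (M n)%:R + 7) * h n.
Proof.
move=> iM; set l := carrier n.
have -> : P A (P l (eigvec n i A)) - of_real (damping (mu n i)) *: eigvec n i A
    = P A (P l (eigvec n i A - eigvec n i l)
           + of_real (damping (mu n i)) *: (tilted n i l - tilted n i A)).
  rewrite orth_projB // proj_eigvec // scalerBr addrA subrK orth_projB //.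
  by rewrite orth_projZ // proj_tilted_flat.
apply: le_trans (nrm_orth_proj _ _) _ => //.
apply: le_trans (nrm_triangle _ _) _.
have : nrm (P l (eigvec n i A - eigvec n i l)) <= (2 * (M n)%:R + 3) * h n.
  apply: le_trans (nrm_orth_proj _ _) _ => //; exact: eigvec_close.
have : nrm (of_real (damping (mu n i)) *: (tilted n i l - tilted n i A))
    <= (2 * (M n)%:R + 4) * h n.
  by apply: nrmZ_le1; [exact: damping_norm1|exact: tilted_close].
by move=> *; lra.
Qed.

Lemma damp_combo n (c : nat -> R) : (forall i, (i < M n)%N -> `|c i| <= 2) ->
  nrm (P A (P (carrier n) (\sum_(i < M n) of_real (c i) *: eigvec n i A))
       - \sum_(i < M n) of_real (damping (mu n i) * c i) *: eigvec n i A)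
  <= 2 * (M n)%:R * ((4 * (M n)%:R + 7) * h n).
Proof.
move=> c2; rewrite !orth_proj_sum // -sumrB.
apply: le_trans (ler_nrm_sum _ _ _) _.
have -> : 2 * (M n)%:R * ((4 * (M n)%:R + 7) * h n)
    = \sum_(i < M n) 2 * ((4 * (M n)%:R + 7) * h n).
  by rewrite sumr_const card_ord -[RHS]mulr_natl; ring.
apply: ler_sum => i _; rewrite mulrC rmorphM -scalerA !orth_projZ // -scalerBr.
rewrite nrmZ ler_pM ?normr_ge0 ?nrm_ge0 ?c2 //; exact: damp_eigvec.
Qed.

(** Errors of successive steps only add up because projections are
    contractions. *)
Lemma damp_iter n (c : nat -> R) q : (forall i, (i < M n)%N -> `|c i| <= 2) ->
  nrm (iter q (fun x => P A (P (carrier n) x))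
         (\sum_(i < M n) of_real (c i) *: eigvec n i A)
       - \sum_(i < M n) of_real (damping (mu n i) ^+ q * c i) *: eigvec n i A)
  <= q%:R * (2 * (M n)%:R * ((4 * (M n)%:R + 7) * h n)).
Proof.
move=> c2; elim: q => [|q IH].
  rewrite mul0r [X in _ - X](eq_bigr (fun i : 'I__ => of_real (c i) *: eigvec n i A)).
    by rewrite subrr nrm0.
  by move=> i _; rewrite expr0 mul1r.
set x := iter q _ _ in IH *; set y := \sum_(i < M n) _ in IH.
rewrite iterS -/x; apply: le_trans (nrm_dist (P A (P (carrier n) y)) _ _) _.
rewrite -natr1 mulrDl mul1r lerD //.
  rewrite -!orth_projB //; apply: le_trans IH.
  by apply: le_trans (nrm_orth_proj _ _) _ => //; exact: nrm_orth_proj.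
rewrite (eq_bigr (fun i : 'I__ => of_real (damping (mu n i) *
  (damping (mu n i) ^+ q * c i)) *: eigvec n i A)); last first.
  by move=> i _; rewrite exprS mulrA.
apply: (@damp_combo n (fun i => damping (mu n i) ^+ q * c i)) => i iM.
rewrite normrM -[leRHS]mul1r.
by rewrite ler_pM ?normr_ge0 ?c2 // normrX exprn_ile1 ?normr_ge0 ?damping_norm1.
Qed.

Variables (n : nat) (om : R).
Hypotheses (hn : h n <= om / 2) (hn1 : h n.+1 <= om / 2).
Hypotheses (mun : \sum_(i < M n) mu n i <= om / 2)
           (mun1 : \sum_(i < M n.+1) mu n.+1 i <= om / 2).

Lemma tilt_sum m (p : nat -> R) k : (forall i, (i < M m)%N -> `|p i| <= 1) ->
  nrm (\sum_(i < M m) of_real (p i) *: eigvec m i k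
       - \sum_(i < M m) of_real (p i) *: tilted m i k) <= \sum_(i < M m) mu m i.
Proof.
move=> p_le; rewrite -sumrB; apply: le_trans (ler_nrm_sum _ _ _) _.
apply: ler_sum => i _; rewrite -scalerBr nrmZ_le1 ?p_le //.
rewrite opprD addNKr nrmN nrmZ v_unit mulr1 ger0_norm //.
by have /andP[] := mu_le1 m i.
Qed.

(** A subspace other than B and C contains a member of the same cluster. The
    axis n+1 belongs to the blocks n and n+1, one of which is tilted inside B
    and the other inside C; untilting a combination of tilted vectors moves it by
    at most the sum of the slopes. *)
Lemma near_axis k a :
  nrm (P k (v (axis n.+1) a) - v (axis n.+1) a) <= om.
Proof.
rewrite nrmC; set e := v (axis n.+1).
have om_h : om / 2 <= om by have := le_trans (h_ge0 n) hn => *; lra.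
suff [g Lg eg] : exists2 g, trimmed k g & nrm (e a - g) <= om.
  exact: le_trans (orth_proj_nearest (closed_trimmed k) _ Lg) eg.
have ek : nrm (e a - e k) <= om / 2.
  by apply: le_trans hn1; rewrite h_close // /block eqxx.
have tilt_case m (p : nat -> R) : carrier m = k ->
    e k = \sum_(i < M m) of_real (p i) *: eigvec m i k ->
    (forall i, (i < M m)%N -> `|p i| <= 1) -> \sum_(i < M m) mu m i <= om / 2 ->
    exists2 g, trimmed k g & nrm (e a - g) <= om.
  move=> mk ekE p_le mum.
  exists (\sum_(i < M m) of_real (p i) *: tilted m i k).
    apply: subspace_sum => // i _; apply: (subspaceZ _ (closed_trimmed k)).
    by rewrite -mk; exact: trimmed_tilted.
  apply: le_trans (nrm_dist (e k) _ _) _.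
  by rewrite [X in _ + nrm (X - _)]ekE; have := tilt_sum k p_le => *; lra.
have [kn|kn] := eqVneq (carrier n) k.
  apply: (tilt_case n (p2 n)) => // [|i iM]; last by rewrite (frame_le1 iM).
  exact: (eigvec_sum_axis _ _ _ _ _ _).2.
have [kn1|kn1] := eqVneq (carrier n.+1) k.
  apply: (tilt_case n.+1 (p1 n.+1)) => // [|i iM]; last by rewrite (frame_le1 iM).
  exact: (eigvec_sum_axis _ _ _ _ _ _).1.
exists (e k); last exact: le_trans ek om_h.
apply: trimmed_flat => //.
- apply/eqP => kE; move: kn kn1; rewrite kE /carrier /=.
  by case: (odd n); rewrite /= eqxx.
- apply/eqP => kE; move: kn kn1; rewrite kE /carrier /=.
  by case: (odd n); rewrite /= eqxx.
Qed.

End Stage.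

Section Compression.
Variables (A : 'I_K) (AB : A != B) (AC : A != C) (n : nat) (om : R).
Local Notation E1 := (v (axis n) A).
Local Notation E2 := (v (axis n.+1) A).
Local Notation Q := (P (carrier n.+1)).
Hypotheses (om1 : nrm (Q E1 - E1) <= om) (om2 : nrm (Q E2 - E2) <= om).

Lemma proj_eigvec_other i :
  Q (eigvec n i A) = of_real (p1 n i) *: Q E1 + of_real (p2 n i) *: Q E2.
Proof.
have combo0 (p : nat -> R) :
    Q (\sum_(j < M n) of_real (p j) *: v (core n j) A) = 0.
  rewrite orth_proj_sum // big1 // => j _.
  by rewrite orth_projZ // proj_core_other scaler0.
rewrite !orth_projD // !orth_projZ // !orth_projB // !combo0.
by rewrite proj_core_other add0r !subr0.
Qed.

Definition compressed q a b (p : nat -> R) : R :=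
  \sum_(i < M n) damping (mu n i) ^+ q * (a * p1 n i + b * p2 n i) * p i.

Lemma compressed_le2 q a b (p : nat -> R) : `|a| <= 1 -> `|b| <= 1 ->
  \sum_(i < M n) p i ^+ 2 = 1 -> `|compressed q a b p| <= 2.
Proof.
move=> a1 b1 pp; apply: le_trans (ler_norm_sum _ _ _) _.
have -> : 2 = \sum_(i < M n) (p1 n i ^+ 2 + p2 n i ^+ 2 + 2 * p i ^+ 2) / 2 :> R.
  rewrite -mulr_suml !big_split /= -mulr_sumr p11 p22 pp; lra.
apply: ler_sum => i _; rewrite !normrM.
have d1 : `|damping (mu n i) ^+ q| <= 1.
  by rewrite normrX exprn_ile1 ?normr_ge0 ?damping_norm1.
have c1 : `|a * p1 n i + b * p2 n i| <= `|p1 n i| + `|p2 n i|.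
  apply: le_trans (ler_normD _ _) _; rewrite !normrM.
  by rewrite lerD // -[leRHS]mul1r ler_wpM2r.
have := real_normK (num_real (p1 n i)); have := real_normK (num_real (p2 n i)).
have := real_normK (num_real (p i)) => <- <- <-.
move: c1 d1 (normr_ge0 (p i)) (normr_ge0 (p1 n i)) (normr_ge0 (p2 n i))
  (normr_ge0 (damping (mu n i) ^+ q)) (normr_ge0 (a * p1 n i + b * p2 n i)).
move: `|p i| `|p1 n i| `|p2 n i| `|_ ^+ q| `|a * _ + _| => x y z d c.
move=> c1 d1 x0 y0 z0 d0 c0.
have dc : d * c <= y + z by nra.
have dcx : d * c * x <= (y + z) * x by rewrite ler_wpM2r.
have := sqr_ge0 (x - y); have := sqr_ge0 (x - z); rewrite !sqrrB.
lra.
Qed.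

(** The q-th power of P_A P_B multiplies the coordinates on the eigenvectors by
    powers of the damping factors. The projection Q onto the other subspace
    forgets the core vectors and nearly fixes the axes, so it compresses the
    result to the plane. *)
Lemma compression_step q a b : `|a| <= 1 -> `|b| <= 1 ->
  nrm (Q (iter q (fun x => P A (P (carrier n) x))
            (of_real a *: E1 + of_real b *: E2))
       - (of_real (compressed q a b (p1 n)) *: E1
          + of_real (compressed q a b (p2 n)) *: E2))
  <= q%:R * (2 * (M n)%:R * ((4 * (M n)%:R + 7) * h n)) + 4 * om.
Proof.
move=> a1 b1; pose c i := a * p1 n i + b * p2 n i.
have c2 i : (i < M n)%N -> `|c i| <= 2.
  move=> iM; have [q1 q2] := frame_le1 iM.
  apply: le_trans (ler_normD _ _) _; rewrite !normrM.
  have := ler_pM (normr_ge0 a) (normr_ge0 (p1 n i)) a1 q1.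
  have := ler_pM (normr_ge0 b) (normr_ge0 (p2 n i)) b1 q2.
  by move=> *; lra.
have [x1 x2] := eigvec_sum_axis v p11 p22 p12 n A.
have -> : of_real a *: E1 + of_real b *: E2
    = \sum_(i < M n) of_real (c i) *: eigvec n i A.
  rewrite x1 x2 !scaler_sumr -big_split /=; apply: eq_bigr => i _.
  by rewrite !scalerA -!rmorphM -scalerDl -rmorphD.
have := damp_iter AB AC q c2; set x := iter q _ _; set y := \sum_(i < M n) _ => xy.
have Qy : Q y = of_real (compressed q a b (p1 n)) *: Q E1
              + of_real (compressed q a b (p2 n)) *: Q E2.
  rewrite /y orth_proj_sum // !rmorph_sum !scaler_suml -big_split /=.
  apply: eq_bigr => i _; rewrite orth_projZ // proj_eigvec_other scalerDr.
  by rewrite !scalerA -!rmorphM.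
apply: le_trans (nrm_dist (Q y) _ _) _; apply: lerD.
  by rewrite -orth_projB //; apply: le_trans (nrm_orth_proj _ _) xy.
rewrite Qy opprD addrACA -!scalerBr; apply: le_trans (nrm_triangle _ _) _.
rewrite !nrmZ; have := nrm_ge0 (Q E1 - E1); have := nrm_ge0 (Q E2 - E2).
have := compressed_le2 q a1 b1 (p11 n); have := compressed_le2 q a1 b1 (p22 n).
move=> z1 z2 y1 y2.
have := ler_pM (normr_ge0 _) y2 z2 om1; have := ler_pM (normr_ge0 _) y1 z1 om2.
by move=> *; lra.
Qed.

End Compression.

End Spaces.

(** * Turning through a right angle *)

Section Selection.
Context {R : realType}.

(** Of the directions i < k, those after j are not yet damped, and those before
    j have little weight in total: the sum reduces to its j-th term. *)
Lemma select_direction k j (b w y : nat -> R) (e : R) : (j < k)%N ->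
  (forall i, (i < k)%N -> 0 <= b i) -> \sum_(i < k) b i <= 1 -> 0 <= e ->
  (forall i, 0 <= w i <= 1) -> w j <= e ->
  (forall i, (j < i < k)%N -> 1 - w i <= e) ->
  (forall i, `|y i| <= 2) ->
  `|\sum_(i < k) (1 - w i) * (b i * y i) - b j * y j|
    <= 2 * \sum_(i < j) b i + 2 * e.
Proof.
move=> jk b0 b1 e0 w01 wj wi y2.
have -> : b j * y j = \sum_(i < k) (i == j :> nat)%:R * (b i * y i).
  rewrite (bigD1 (Ordinal jk)) //= eqxx mul1r big1 ?addr0 // => i ij.
  by rewrite (_ : (i == j :> nat) = false) ?mul0r //; exact: negPf.
rewrite -sumrB; apply: le_trans (ler_norm_sum _ _ _) _.
have h : \sum_(i < k) 2 * (b i * ((i < j)%N%:R + e)) <=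
    2 * \sum_(i < j) b i + 2 * e.
  rewrite -mulr_sumr -mulrDr ler_pM2l //.
  under eq_bigr do rewrite mulrDr.
  rewrite big_split /= -mulr_suml lerD //.
    rewrite (big_ord_widen k b (ltnW jk)) [leRHS]big_mkcond /= ler_sum // => i _.
    by case: ifP => _; rewrite ?mulr1 ?mulr0.
  by rewrite -[leRHS]mul1r ler_wpM2r.
apply: le_trans h; apply: ler_sum => i _.
rewrite -mulrBl !normrM (ger0_norm (b0 _ (ltn_ord i))).
have c : `|1 - w i - (i == j :> nat)%:R| <= (i < j)%N%:R + e.
  have /andP[w0 w1] := w01 i; have /andP[wj0 wj1] := w01 j.
  case: ltngtP => [ij|ji|->] /=.
  - rewrite subr0 ger0_norm; lra.
  - have := wi i; rewrite ji ltn_ord => /(_ isT) w_le.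
    by rewrite subr0 ger0_norm; lra.
  - by rewrite addrAC subrr add0r normrN ger0_norm // add0r.
have := b0 _ (ltn_ord i); have := y2 i.
move: (normr_ge0 (y i)) (normr_ge0 (1 - w i - (i == j :> nat)%:R)) c.
move: `|_ - _| `|y i| (b i) (_ + e) => x z u f z0 x0 xf z2 u0.
have : x * (u * z) <= f * (u * 2).
  by rewrite ler_pM ?mulr_ge0 // ler_wpM2l.
lra.
Qed.

End Selection.

Section Rotation.
Context {R : realType} {s : scalars} {H : hilbertType R s}.
Local Notation of_real := (@of_real R s).
Variables E1 E2 : H.
Hypotheses (E1_unit : nrm E1 = 1) (E2_unit : nrm E2 = 1).

Definition plane a b : H := of_real a *: E1 + of_real b *: E2.
Definition circle t : H := plane (cos t) (sin t).

Lemma planeZ c a b : of_real c *: plane a b = plane (c * a) (c * b).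
Proof. by rewrite /plane scalerDr !scalerA -!rmorphM. Qed.

Lemma planeB a b c d : plane a b - plane c d = plane (a - c) (b - d).
Proof. by rewrite /plane opprD addrACA -!scalerBl -!rmorphB. Qed.

Lemma nrm_plane a b : nrm (plane a b) <= `|a| + `|b|.
Proof.
by apply: le_trans (nrm_triangle _ _) _; rewrite !nrmZ E1_unit E2_unit !mulr1.
Qed.

(** f nearly multiplies the component along the normal direction at phi by
    1 - beta and fixes the direction phi itself. Iterating it on the unit vector
    at phi - t leaves the component cos t along the direction phi. *)
Lemma line_projection (f : H -> H) phi t beta rho r :
  (forall x y, nrm (f x - f y) <= nrm (x - y)) -> 0 <= beta <= 1 ->
  (forall a b, `|a| <= 1 -> `|b| <= 1 ->
    nrm (f (plane a b)
      - plane (a - beta * ((a * - sin phi + b * cos phi) * - sin phi))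
              (b - beta * ((a * - sin phi + b * cos phi) * cos phi))) <= rho) ->
  nrm (iter r f (circle (phi - t)) - of_real (cos t) *: circle phi)
    <= r%:R * rho + 2 * (1 - beta) ^+ r.
Proof.
move=> f_lip /andP[be0 be1] f_step.
have sc := cos2Dsin2 phi.
(* coordinates of the exact path; they stay in [-1, 1], where f is controlled,
   since they are convex combinations of their first values and their limits *)
pose a n := cos t * cos phi + (1 - beta) ^+ n * (sin t * sin phi).
pose b n := cos t * sin phi - (1 - beta) ^+ n * (sin t * cos phi).
have q01 n : 0 <= (1 - beta) ^+ n <= 1.
  by rewrite exprn_ge0 ?exprn_ile1 //; lra.
have prod1 (x y : R) : `|x| <= 1 -> `|y| <= 1 -> `|x * y| <= 1.
  by move=> *; rewrite normrM -[leRHS]mulr1 ler_pM.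
have convex (q x y : R) : 0 <= q <= 1 -> `|x| <= 1 -> `|y| <= 1 ->
    `|(1 - q) * x + q * y| <= 1.
  move=> /andP[q0 q1]; rewrite !ler_norml => /andP[? ?] /andP[? ?].
  by apply/andP; split; nra.
have a1 n : `|a n| <= 1.
  have -> : a n = (1 - (1 - beta) ^+ n) * (cos t * cos phi)
      + (1 - beta) ^+ n * cos (phi - t) by rewrite /a cosB; ring.
  by rewrite convex ?prod1 ?cos_max.
have b1 n : `|b n| <= 1.
  have -> : b n = (1 - (1 - beta) ^+ n) * (cos t * sin phi)
      + (1 - beta) ^+ n * sin (phi - t) by rewrite /b sinB; ring.
  by rewrite convex ?prod1 ?cos_max ?sin_max.
have path n : nrm (iter n f (circle (phi - t)) - plane (a n) (b n)) <= n%:R * rho.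
  elim: n => [|n IH].
    have -> : iter 0 f (circle (phi - t)) = plane (a 0%N) (b 0%N).
      rewrite /= /circle cosB sinB /a /b expr0 !mul1r.
      by congr plane; ring.
    by rewrite subrr nrm0 mul0r.
  rewrite iterS; apply: le_trans (nrm_dist (f (plane (a n) (b n))) _ _) _.
  rewrite -natr1 mulrDl mul1r lerD // ?(le_trans (f_lip _ _)) //.
  apply: le_trans (f_step _ _ (a1 n) (b1 n)); rewrite le_eqVlt; apply/orP; left.
  have g : a n * - sin phi + b n * cos phi = - ((1 - beta) ^+ n * sin t).
    transitivity (- ((1 - beta) ^+ n * sin t * (cos phi ^+ 2 + sin phi ^+ 2))).
      by rewrite /a /b; ring.
    by rewrite sc mulr1.
  apply/eqP; congr (nrm (_ - plane _ _)); rewrite g /a /b exprS; ring.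
apply: le_trans (nrm_dist (plane (a r) (b r)) _ _) _; apply: lerD => //.
rewrite /circle planeZ planeB; apply: le_trans (nrm_plane _ _) _.
rewrite /a /b addrAC subrr add0r addrAC subrr add0r normrN.
rewrite !normrM; have /andP[q0 _] := q01 r; rewrite (ger0_norm q0).
have := prod1 _ _ (sin_max t) (sin_max phi).
have := prod1 _ _ (sin_max t) (cos_max phi).
rewrite !normrM; move: (_ ^+ r) q0 (`|sin t| * _) (`|sin t| * _) => q q0 x y *.
by nra.
Qed.

(** Line j is at angle (j+1) pi / 2k, so that the last line is spanned by E2.
    Homogeneity of f allows one to rescale after each line, and the factor
    cos (pi / 2k) lost there does not increase the errors. *)
Lemma quarter_turn k (f : nat -> H -> H) (beta rho : nat -> R) (r : nat -> nat) :
  (0 < k)%N -> 0 <= cos (angle k : R) ->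
  (forall j x y, nrm (f j x - f j y) <= nrm (x - y)) ->
  (forall j (c : R) x, f j (of_real c *: x) = of_real c *: f j x) ->
  (forall j, (j < k)%N -> 0 <= beta j <= 1) ->
  (forall j, (j < k)%N -> forall a b, `|a| <= 1 -> `|b| <= 1 ->
    let phi := angle k * j.+1%:R in
    nrm (f j (plane a b)
      - plane (a - beta j * ((a * - sin phi + b * cos phi) * - sin phi))
              (b - beta j * ((a * - sin phi + b * cos phi) * cos phi))) <= rho j) ->
  nrm (foldl (fun x j => iter (r j) (f j) x) E1 (iota 0 k) - E2) <=
    \sum_(j < k) ((r j)%:R * rho j + 2 * (1 - beta j) ^+ r j)
    + (1 - cos (angle k) ^+ k).
Proof.
move=> k0 c0 f_lip fZ beta01 f_step; set th := angle k.
have iter_lip n j x y : nrm (iter n (f j) x - iter n (f j) y) <= nrm (x - y).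
  by elim: n => // n IH; rewrite !iterS (le_trans (f_lip _ _ _)).
have iterZ n j (c : R) x :
    iter n (f j) (of_real c *: x) = of_real c *: iter n (f j) x.
  by elim: n => // n IH; rewrite !iterS IH fZ.
pose g n := foldl (fun x j => iter (r j) (f j) x) E1 (iota 0 n).
have main n : (n <= k)%N ->
    nrm (g n - of_real (cos th ^+ n) *: circle (th * n%:R)) <=
    \sum_(j < n) ((r j)%:R * rho j + 2 * (1 - beta j) ^+ r j).
  elim: n => [|n IH] nk.
    rewrite big_ord0 /g /= expr0 rmorph1 scale1r mulr0 /circle cos0 sin0 /plane.
    by rewrite rmorph1 rmorph0 scale1r scale0r addr0 subrr nrm0.
  rewrite /g -[in iota _ _]addn1 iotaD foldl_cat /= add0n -/(g n) big_ord_recr /=.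
  set x := of_real (cos th ^+ n) *: circle (th * n%:R) in IH.
  apply: le_trans (nrm_dist (iter (r n) (f n) x) _ _) _; apply: lerD.
    exact: le_trans (iter_lip _ _ _ _) (IH (ltnW nk)).
  have := line_projection th (r n) (f_lip n) (beta01 n nk) (f_step n nk).
  have -> : angle k * n.+1%:R - th = th * n%:R by rewrite /th -natr1; ring.
  apply: le_trans; rewrite /x iterZ exprSr rmorphM -scalerA -scalerBr.
  apply: nrmZ_le1 => //.
  by rewrite normrX exprn_ile1 ?normr_ge0 ?cos_max.
apply: le_trans (nrm_dist (of_real (cos th ^+ k) *: circle (th * k%:R)) _ _) _.
apply: lerD; first exact: main.
have -> : circle (th * k%:R) = E2.
  rewrite /th /angle divfK ?pnatr_eq0 -?lt0n // /circle /plane cos_pihalf.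
  by rewrite sin_pihalf rmorph0 rmorph1 scale0r scale1r add0r.
rewrite -{2}[E2]scale1r -(rmorph1 of_real) -scalerBl -rmorphB nrmZ E2_unit.
by rewrite mulr1 distrC ger0_norm // subr_ge0 exprn_ile1 // cos_le1.
Qed.

End Rotation.

(** * Words of projections *)

Section Words.
Context {R : realType} {s : scalars} {H : hilbertType R s} {K : nat}.
Local Notation of_real := (@of_real R s).
Variable L : 'I_K -> set H.
Hypothesis L_closed : forall k, closed_subspace (L k).

Definition run (w : seq 'I_K) (x : H) : H :=
  foldl (fun y k => orth_proj (L k) y) x w.

Lemma run_cat w1 w2 x : run (w1 ++ w2) x = run w2 (run w1 x).
Proof. exact: foldl_cat. Qed.

Lemma run_nseq n w x : run (flatten (nseq n w)) x = iter n (run w) x.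
Proof. by elim: n x => // n IH x; rewrite /= run_cat IH -iterSr. Qed.

Lemma run_lip w x y : nrm (run w x - run w y) <= nrm (x - y).
Proof.
elim: w x y => // k w IH x y; apply: le_trans (IH _ _) _.
by rewrite -orth_projB // nrm_orth_proj.
Qed.

Lemma runZ w (c : R) x : run w (of_real c *: x) = of_real c *: run w x.
Proof. by elim: w x => // k w IH x; rewrite /= orth_projZ // IH. Qed.

Lemma run_near w x (e : R) : (forall k, nrm (orth_proj (L k) x - x) <= e) ->
  nrm (run w x - x) <= (size w)%:R * e.
Proof.
move=> xe; elim: w => [|k w IH]; first by rewrite subrr nrm0 mul0r.
apply: le_trans (nrm_dist (run w x) _ _) _; rewrite /= -natr1 mulrDl mul1r addrC.
by rewrite lerD //; apply: le_trans (run_lip _ _ _) _.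
Qed.

End Words.

Section StageWord.
Context {R : realType} {s : scalars} {H : hilbertType R s} {K : nat}.
Local Notation of_real := (@of_real R s).
Variable v : atom -> 'I_K -> H.
Hypothesis v_unit : forall t k, nrm (v t k) = 1.
Hypothesis v_perp : forall t u k l, t != u -> inner (v t k) (v u l) = 0.
Variables (M : nat -> nat) (p1 p2 mu : nat -> nat -> R).
Hypothesis p11 : forall n, \sum_(i < M n) p1 n i ^+ 2 = 1.
Hypothesis p22 : forall n, \sum_(i < M n) p2 n i ^+ 2 = 1.
Hypothesis p12 : forall n, \sum_(i < M n) p1 n i * p2 n i = 0.
Variables A B C : 'I_K.
Hypotheses (BC : B != C) (AB : A != B) (AC : A != C).
Variable h : nat -> R.
Hypothesis h_close : forall n t k l, block n t -> nrm (v t k - v t l) <= h n.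
Hypothesis mu_le1 : forall n i, 0 <= mu n i <= 1.
Local Notation space := (trimmed v M p1 p2 mu B C).

(** The word is made of all indices once, followed for each line j by r_j copies
    of q_j alternations between B and A (or between C and A, according to the
    parity of the block) and one projection onto the third subspace. The stage
    lives in block n+1, because both of its axes then belong to a second
    block. *)
Lemma stage_word n k (b m : nat -> R) (r q : nat -> nat) (om e : R) :
  (0 < k)%N -> 0 <= cos (angle k : R) -> 0 < om ->
  (forall j, (j < k)%N -> 0 < b j) -> \sum_(j < k) b j <= 1 ->
  K%:R * om + \sum_(j < k) ((r j)%:R * (8 * om + 4 * \sum_(i < j) b i)
                            + 2 * (1 - b j) ^+ r j)
    + (1 - cos (angle k) ^+ k) <= e / 2 ->
  (forall j, (j < k)%N -> damping (m j) ^+ q j <= om /\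
    forall i, (j < i < k)%N -> 1 - damping (m i) ^+ q j <= om) ->
  M n.+1 = k.*2.+2 ->
  p1 n.+1 = frame1 k b (fun i => - sin (angle k * i.+1%:R))
                       (fun i => cos (angle k * i.+1%:R)) ->
  p2 n.+1 = frame2 k b (fun i => - sin (angle k * i.+1%:R))
                       (fun i => cos (angle k * i.+1%:R)) ->
  mu n.+1 = (fun i => if (i < k.*2)%N && ~~ odd i then m i./2 else 0) ->
  (forall l, (n <= l <= n.+2)%N ->
    h l <= om / 2 /\ \sum_(i < M l) mu l i <= om / 2) ->
  \sum_(j < k) (r j)%:R * ((q j)%:R *
    (2 * (M n.+1)%:R * ((4 * (M n.+1)%:R + 7) * h n.+1))) <= e / 2 ->
  exists w : seq 'I_K, (forall i, i \in w) /\
    nrm (run space w (v (axis n.+1) A) - v (axis n.+2) A) <= e.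
Proof.
move=> k0 c0 om0 b0 b1 plan scales MN P1 P2 MU nb fine.
pose N := n.+1; set E1 := v (axis n.+1) A; set E2 := v (axis n.+2) A.
have cL l : closed_subspace (space l) by exact: closed_trimmed.
have [hn mun] : h n <= om / 2 /\ \sum_(i < M n) mu n i <= om / 2.
  by apply: nb; rewrite leqnn /= ltnW.
have [hN muN] : h N <= om / 2 /\ \sum_(i < M N) mu N i <= om / 2.
  by apply: nb; rewrite leqnSn /=.
have [hN1 muN1] : h N.+1 <= om / 2 /\ \sum_(i < M N.+1) mu N.+1 i <= om / 2.
  by apply: nb; rewrite leqnn ltnW /=.
have near1 l : nrm (orth_proj (space l) E1 - E1) <= om.
  exact: (near_axis v_unit p11 p22 p12 B C h_close mu_le1 hn hN mun muN).
have near2 l : nrm (orth_proj (space l) E2 - E2) <= om.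
  exact: (near_axis v_unit p11 p22 p12 B C h_close mu_le1 hN hN1 muN muN1).
pose kap := 2 * (M N)%:R * ((4 * (M N)%:R + 7) * h N).
pose macro j := flatten (nseq (q j) [:: carrier B C N; A]) ++ [:: carrier B C N.+1].
pose w := flatten [seq flatten (nseq (r j) (macro j)) | j <- iota 0 k].
exists (enum 'I_K ++ w); split=> [i|]; first by rewrite mem_cat mem_enum.
have run_w x : run space w x =
    foldl (fun x j => iter (r j) (run space (macro j)) x) x (iota 0 k).
  rewrite /w; elim: (iota 0 k) x => // j js IH x /=.
  by rewrite run_cat run_nseq IH.
rewrite run_cat; apply: le_trans (nrm_dist (run space w E1) _ _) _.
have lead : nrm (run space w (run space (enum 'I_K) E1) - run space w E1)
    <= K%:R * om.
  apply: le_trans (run_lip cL _ _ _) _.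
  by have := run_near cL (enum 'I_K) near1; rewrite size_enum_ord.
rewrite !run_w in lead *.
have E1u : nrm E1 = 1 by exact: v_unit.
have E2u : nrm E2 = 1 by exact: v_unit.
pose g1 i : R := - sin (angle k * i.+1%:R); pose g2 i : R := cos (angle k * i.+1%:R).
have g_unit i : g1 i ^+ 2 + g2 i ^+ 2 = 1 by rewrite sqrrN addrC cos2Dsin2.
have b_ge0 i : (i < k)%N -> 0 <= b i by move=> /b0/ltW.
have b01 j : (j < k)%N -> 0 <= b j <= 1.
  move=> jk; rewrite b_ge0 //=; apply: le_trans b1.
  rewrite (bigD1 (Ordinal jk)) //= lerDl.
  by apply: sumr_ge0 => i _; exact: b_ge0.
have step j : (j < k)%N -> forall x y, `|x| <= 1 -> `|y| <= 1 ->
    nrm (run space (macro j) (plane E1 E2 x y)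
      - plane E1 E2 (x - b j * ((x * g1 j + y * g2 j) * g1 j))
                    (y - b j * ((x * g1 j + y * g2 j) * g2 j)))
    <= (q j)%:R * kap + 8 * om + 4 * \sum_(i < j) b i.
  move=> jk x y x1 y1.
  have := compression_step v_unit v_perp p11 p22 p12 BC h_close mu_le1 AB AC
    (near1 _) (near2 _) (q j) x1 y1.
  set z := orth_proj _ (iter _ _ _).
  have -> : run space (macro j) (plane E1 E2 x y) = z by rewrite run_cat run_nseq.
  rewrite -/(plane E1 E2 _ _) -/kap.
  set cx := compressed _ _ _ _ _ _ _ _ _; set cy := compressed _ _ _ _ _ _ _ _ _.
  move=> zE; apply: le_trans (nrm_dist (plane E1 E2 cx cy) _ _) _.
  apply: le_trans (lerD zE (lexx _)) _; rewrite planeB.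
  apply: le_trans (lerD (lexx _) (nrm_plane E1u E2u _ _)) _.
  have [w01 wj wi] : [/\ forall i, 0 <= damping (mu N i.*2) ^+ q j <= 1,
      damping (mu N j.*2) ^+ q j <= om & forall i, (j < i < k)%N ->
      1 - damping (mu N i.*2) ^+ q j <= om].
    have mN i : (i < k)%N -> mu N i.*2 = m i.
      by move=> ik; rewrite MU ltn_double ik odd_double doubleK.
    have [sj si] := scales j jk; split=> [i||i /andP[ji ik]].
    - by rewrite exprn_ge0 ?exprn_ile1 ?damping_le1 // ltW // damping_gt0.
    - by rewrite mN.
    - by rewrite mN // si // ji.
  have sel (g : nat -> R) (g_le1 : forall i, `|g i| <= 1) :
      `|\sum_(i < k) (1 - damping (mu N i.*2) ^+ q j)
           * (b i * ((x * g1 i + y * g2 i) * g i))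
        - b j * ((x * g1 j + y * g2 j) * g j)|
      <= 2 * \sum_(i < j) b i + 2 * om.
    apply: (select_direction (w := fun i => damping (mu N i.*2) ^+ q j)
      (y := fun i => (x * g1 i + y * g2 i) * g i)) => // [|i]; first exact: ltW.
    have c1 : `|x * g1 i| <= 1.
      by rewrite normrM -[leRHS]mulr1 ler_pM // normrN sin_max.
    have c2 : `|y * g2 i| <= 1.
      by rewrite normrM -[leRHS]mulr1 ler_pM // cos_max.
    rewrite normrM -[leRHS]mulr1 ler_pM //.
    by apply: le_trans (ler_normD _ _) _; lra.
  have [cxE cyE] : cx = x - \sum_(i < k) (1 - damping (mu N i.*2) ^+ q j) *
      (b i * ((x * g1 i + y * g2 i) * g1 i)) /\
    cy = y - \sum_(i < k) (1 - damping (mu N i.*2) ^+ q j) *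
      (b i * ((x * g1 i + y * g2 i) * g2 i)).
    have [] := @frame_sum R k b g1 g2 b_ge0 b1 g_unit
      (fun i => damping (mu N i) ^+ q j) x y.
    - by move=> i ik; rewrite MU /= odd_double andbF damping0 expr1n.
    - by rewrite MU ltnn damping0 expr1n.
    - by rewrite MU ltnNge leqnSn damping0 expr1n.
    rewrite -MN -P1 -P2 => X1 X2; split.
      by rewrite /cx /compressed X1; congr (_ - _); apply: eq_bigr => i _; ring.
    by rewrite /cy /compressed X2; congr (_ - _); apply: eq_bigr => i _; ring.
  have g1_le1 i : `|g1 i| <= 1 by rewrite normrN sin_max.
  have := sel g1 g1_le1; have := sel g2 (fun i => cos_max _).
  rewrite cxE cyE; set X := \sum_(i < k) _; set Y := \sum_(i < k) _.
  have opp (u d d' : R) : `|u - d - (u - d')| = `|d - d'|.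
    by rewrite -normrN; congr `|_|; ring.
  rewrite !opp => s2 s1; lra.
have := quarter_turn E1u E2u r k0 c0 (fun j => run_lip cL (macro j))
  (fun j => runZ cL (macro j)) b01 step.
move=> turn; apply: le_trans (lerD lead turn) _.
rewrite (_ : \sum_(j < k) _ = \sum_(j < k) (r j)%:R * ((q j)%:R * kap)
  + \sum_(j < k) ((r j)%:R * (8 * om + 4 * \sum_(i < j) b i)
                  + 2 * (1 - b j) ^+ r j)); last first.
  by rewrite -big_split; apply: eq_bigr => j _ /=; ring.
rewrite -/N -/kap in fine; move: plan fine.
by move: (\sum_(j < k) _) (\sum_(j < k) _) => *; lra.
Qed.

End StageWord.

(** * Iterates that do not converge *)

(** tau n is the position at which the n-th word starts. Since words are not
    empty, the letter at position t is found in the concatenation of the first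
    t + 1 words. *)
Lemma concatenation (T : Type) (x0 : T) (W : nat -> seq T) :
  (forall n, (0 < size (W n))%N) ->
  exists (k : nat -> T) (tau : nat -> nat),
  [/\ tau 0%N = 0%N, forall n, tau n.+1 = (tau n + size (W n))%N,
      forall n, (n <= tau n)%N &
      forall n i, (i < size (W n))%N -> k (tau n + i)%N = nth x0 (W n) i].
Proof.
move=> W0; pose pre n := flatten [seq W i | i <- iota 0 n].
have preS n : pre n.+1 = pre n ++ W n.
  by rewrite /pre -addn1 iotaD map_cat flatten_cat /= cats0.
have tauS n : size (pre n.+1) = (size (pre n) + size (W n))%N.
  by rewrite preS size_cat.
have tau_ge n : (n <= size (pre n))%N.
  by elim: n => // n IH; rewrite tauS -addn1 leq_add.
have pre_le m n : (m <= n)%N -> exists s, pre n = pre m ++ s.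
  move=> mn; exists (flatten [seq W i | i <- iota m (n - m)]).
  by rewrite -flatten_cat -map_cat -{2}[m]add0n -iotaD subnKC.
exists (fun t => nth x0 (pre t.+1) t), (fun n => size (pre n)); split=> // n i iW.
have [|s ->] := @pre_le n.+1 (size (pre n) + i).+1.
  by rewrite ltnS (leq_trans (tau_ge n)) // leq_addr.
by rewrite nth_cat tauS ltn_add2l iW preS nth_cat ltnNge leq_addr /= addKn.
Qed.

Lemma unbounded_infinite (A : set nat) :
  (forall N, exists2 n, (N < n)%N & A n) -> infinite_set A.
Proof.
move=> A_ub /finite_seqP[r rA]; have [n n_gt] := A_ub (\max_(i <- r) i).
by rewrite rA /= => nr; move: n_gt; rewrite ltnNge (@leq_bigmax_seq _ r predT id).
Qed.

Section Divergence.
Context {R : realType} {s : scalars} {H : hilbertType R s} {K : nat}.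
Variables (L : 'I_K -> set H) (e : nat -> H) (W : nat -> seq 'I_K) (i0 : 'I_K).
Hypothesis L_closed : forall k, closed_subspace (L k).
Hypothesis e_unit : forall n, nrm (e n) = 1.
Hypothesis e_perp : forall n, inner (e n) (e n.+1) = 0.
Hypothesis W_all : forall n i, i \in W n.
Hypothesis W_step : forall n,
  nrm (run L (W n) (e n) - e n.+1) <= 8^-1 * 2^-1 ^+ n.+1.

(** If z had a limit, then e n and e n.+1 would both be within 1/4 of it for
    large n, but their distance is the square root of 2. *)
Lemma divergent_iterates : exists (k : nat -> 'I_K) (z : nat -> H),
  [/\ forall i, infinite_set [set n | (0 < n)%N /\ k n = i],
      z 0%N = e 0%N, forall n, z n.+1 = orth_proj (L (k n.+1)) (z n) &
      ~ cvgn z].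
Proof.
have W0 n : (0 < size (W n))%N by case: (W n) (W_all n i0).
have [k [tau [tau0 tauS tau_ge kW]]] := concatenation i0 W0.
have [z [z0 zS]] : exists z : nat -> H,
    z 0%N = e 0%N /\ forall m, z m.+1 = orth_proj (L (k m)) (z m).
  by exists (fix z n := if n is m.+1 then orth_proj (L (k m)) (z m) else e 0%N).
have z_run n i : (i <= size (W n))%N ->
    z (tau n + i)%N = run L (take i (W n)) (z (tau n)).
  elim: i => [|i IH] iW; first by rewrite addn0 take0.
  rewrite addnS zS (IH (ltnW iW)).
  rewrite (kW _ _ iW).
  rewrite (take_nth i0 iW).
  rewrite -cats1.
  by rewrite (run_cat L (take i (W n))).
have z_tau n : z (tau n.+1) = run L (W n) (z (tau n)).
  by rewrite tauS z_run ?take_size.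
(* the right-hand side is the sum of the errors of the first n words *)
have z_near n : nrm (z (tau n) - e n) <= 8^-1 - 8^-1 * 2^-1 ^+ n.
  elim: n => [|n IH]; first by rewrite tau0 z0 subrr nrm0 expr0; lra.
  rewrite z_tau; apply: le_trans (nrm_dist (run L (W n) (e n)) _ _) _.
  have := W_step n; have := le_trans (run_lip L_closed (W n) _ _) IH.
  by rewrite exprS; lra.
exists (fun n => k n.-1), z; split=> // [i|].
  apply: unbounded_infinite => N.
  have iW : (index i (W N) < size (W N))%N by rewrite index_mem.
  exists (tau N + index i (W N)).+1.
    by rewrite ltnS (leq_trans (tau_ge N)) // leq_addr.
  by split=> //=; rewrite kW // nth_index.
move=> /cvg_nrm/(_ 8^-1)[|n0 zn0]; first by rewrite invr_gt0.
set l := lim _ in zn0.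
have near_l n : (n0 <= n)%N -> nrm (e n - l) < 4^-1.
  move=> nn; have := zn0 _ (leq_trans nn (tau_ge n)); have := z_near n.
  have := nrm_dist (z (tau n)) (e n) l; rewrite (nrmC (e n) (z _)).
  have : 0 <= 8^-1 * 2^-1 ^+ n :> R by rewrite mulr_ge0 ?exprn_ge0 ?invr_ge0.
  by move: (_ * _) => *; lra.
have := near_l _ (leqnn n0); have := near_l _ (leqnSn n0).
have := nrm_dist l (e n0) (e n0.+1); rewrite (nrmC l).
have : nrm (e n0 - e n0.+1) ^+ 2 = 2.
  rewrite pythagoras_nrm ?nrmN ?e_unit; first by lra.
  by rewrite innerNr e_perp oppr0.
have := nrm_ge0 (e n0 - e n0.+1); clear.
by move: (nrm _) (nrm (_ - l)) (nrm (_ - l)) => *; nra.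
Qed.

End Divergence.

(** * The choice of the parameters *)

Section Membership.
Context {R : realType} {s : scalars} {H : hilbertType R s} {K : nat}.
Variable v : atom -> 'I_K -> H.
Variables (M : nat -> nat) (p1 p2 mu : nat -> nat -> R) (B C : 'I_K).

Lemma generators_sub (L : 'I_K -> set H) k : closed_subspace (L k) ->
  (forall t, L k (v t k)) -> generators v M p1 p2 mu B C k `<=` L k.
Proof.
move=> cL Lv y [[n [i [_ _ ->]]]|[_ _ [t _ ->]]] //.
have comb (p : nat -> R) : L k (\sum_(j < M n) of_real s (p j) *: v (core n j) k).
  by apply: subspace_sum => // j _; exact/(subspaceZ _ cL)/Lv.
apply: (subspaceD cL); last exact/(subspaceZ _ cL)/Lv.
apply: (subspaceD cL); last by apply/(subspaceZ _ cL)/(subspaceB cL).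
by apply: (subspaceD cL) => //; apply/(subspaceZ _ cL)/(subspaceB cL).
Qed.

End Membership.

(** Block l touches the stages of the blocks l - 1, l and l + 1, and its
    tolerances have to suit all three; for l = 0 the predecessor is 0 again,
    which does no harm. *)
Definition neighbour_min (R : realType) (f : nat -> R) l : R :=
  Num.min (f l.-1) (Num.min (f l) (f l.+1)).

Lemma neighbour_min_le (R : realType) (f : nat -> R) n l :
  (n <= l <= n.+2)%N -> neighbour_min f l <= f n.+1.
Proof.
rewrite /neighbour_min => /andP[]; rewrite leq_eqVlt => /predU1P[<- _|nl ln].
  by rewrite !ge_min lexx !orbT.
move: nl; rewrite leq_eqVlt => /predU1P[<-|nl]; first by rewrite !ge_min lexx !orbT.
have -> : l = n.+2 by apply/eqP; rewrite eqn_leq ln.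
by rewrite !ge_min lexx.
Qed.

Lemma neighbour_min_gt0 (R : realType) (f : nat -> R) l :
  (forall n, 0 < f n) -> 0 < neighbour_min f l.
Proof. by move=> f0; rewrite !lt_min !f0. Qed.

Theorem corollary3p5 (R : realType) (s : scalars) (H : hilbertType R s)
    (w : nat -> H) (w_normalized : forall n, `|w n| = 1)
    (w_weakly_null : weakly_null w)
    (K : nat) (K_ge3 : (3 <= K)%N)
    (L : 'I_K -> set H) (L_closed : forall k, closed_subspace (L k))
    (w_near_L : \big[Num.max/0]_(k < K) dist_to (w n) (L k) @[n --> \oo] --> (0 : R)) :
  exists (Lt : 'I_K -> set H) (z0 : H) (k : nat -> 'I_K) (z : nat -> H),
    [/\ forall i, closed_subspace (Lt i) /\ Lt i `<=` L i,
        forall i, infinite_set [set n | (0 < n)%N /\ k n = i],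
        z 0%N = z0,
        forall n, z n.+1 = orth_proj (Lt (k n.+1)) (z n) &
        ~ cvgn z].
Proof.
pose A := Ordinal (leq_trans (isT : 0 < 3)%N K_ge3).
pose B := Ordinal (leq_trans (isT : 1 < 3)%N K_ge3).
pose C := Ordinal (leq_trans (isT : 2 < 3)%N K_ge3).
have [AB AC BC] : [/\ A != B, A != C & B != C] by [].
pose tol n : R := 8^-1 * 2^-1 ^+ n.
have tol0 n : 0 < tol n by rewrite mulr_gt0 ?exprn_gt0 ?invr_gt0.
have tol2 n : 0 < tol n / 2 by rewrite divr_gt0.
have /choice[plan planP] n := rotation_plan K (tol2 n).
have /choice[bs bsP] n := planP n.
have /choice[rs rsP] n := bsP n.
have /choice[om omP] n := rsP n.
pose M n := (plan n).*2.+2.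
have om0 n : 0 < om n by have [[]] := omP n.
(* the slopes of the tilts of block n: their sum over the block must be small
   for the stages of the neighbouring blocks *)
pose d n := Num.min 1 (neighbour_min om n / 2 / (M n)%:R).
have d0 n : 0 < d n.
  by rewrite lt_min ltr01 !divr_gt0 ?neighbour_min_gt0 ?ltr0n.
have /choice[ms msP] n := separated_scales (plan n) (om0 n) (d0 n).
have /choice[qs qsP] n := msP n.
pose g1 n i : R := - sin (angle (plan n) * i.+1%:R).
pose g2 n i : R := cos (angle (plan n) * i.+1%:R).
pose p1 n := frame1 (plan n) (bs n) (g1 n) (g2 n).
pose p2 n := frame2 (plan n) (bs n) (g1 n) (g2 n).
pose mu n i : R := if (i < (plan n).*2)%N && ~~ odd i then ms n i./2 else 0.
have tight n : [/\ \sum_(i < M n) p1 n i ^+ 2 = 1, \sum_(i < M n) p2 n i ^+ 2 = 1 &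
    \sum_(i < M n) p1 n i * p2 n i = 0].
  have [_ b0 b1 _] := omP n.
  apply: (@frame_tight R (plan n) (bs n) (g1 n) (g2 n)) => [i ik||i].
  - exact: ltW (b0 i ik).
  - exact: b1.
  - by rewrite sqrrN addrC cos2Dsin2.
have mu_bound n i : 0 <= mu n i <= d n.
  rewrite /mu; case: ifP => [/andP[ik io]|_]; last by rewrite lexx ltW.
  have ik2 : (i./2 < plan n)%N by rewrite -ltn_double even_halfK.
  by have [-> -> _ _] := qsP n _ ik2.
(* fine n * h n is the error due to the imprecision of the clusters
   in the stage of block n *)
pose fine n := \sum_(j < plan n) (rs n j)%:R *
  ((qs n j)%:R * (2 * (M n)%:R * (4 * (M n)%:R + 7))) : R.
have fine0 n : 0 <= fine n.
  apply: sumr_ge0 => j _.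
  by do ![exact: ler0n | apply: mulr_ge0 | apply: addr_ge0].
pose h n := Num.min (neighbour_min om n / 2) (tol n / 2 / (fine n + 1)).
have h0 n : 0 < h n.
  by rewrite lt_min !divr_gt0 ?neighbour_min_gt0 // ltr_wpDl.
(* an axis of index a belongs to block a and to block a - 1 *)
pose eta (t : atom) := Num.min (h t.1.-1) (h t.1).
have eta0 t : 0 < eta t by rewrite lt_min !h0.
have wL := dist_max_asymptotically_in L_closed w_near_L.
have [v [vL v_unit v_perp v_close]] :=
  orthogonal_clusters w_weakly_null w_normalized L_closed wL eta0.
have h_close n t k l : block n t -> nrm (v t k - v t l) <= h n.
  move=> nt; apply: le_trans (v_close t k l) _; rewrite /eta ge_min.
  by case/orP: nt => [/eqP ->|/eqP ->] /=; rewrite lexx ?orbT.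
pose Lt := trimmed v M p1 p2 mu B C.
have Lt_closed k : closed_subspace (Lt k) by exact: closed_trimmed.
have stage n : exists W : seq 'I_K, (forall i, i \in W) /\
    nrm (run Lt W (v (axis n.+1) A) - v (axis n.+2) A) <= tol n.+1.
  have [[k0 omn ck] b0 b1 plan_le] := omP n.+1.
  apply: (stage_word v_unit v_perp _ _ _ BC AB AC h_close _ k0 ck omn b0 b1 plan_le
    (m := ms n.+1) (q := qs n.+1)) => //.
  - by move=> m; have [] := tight m.
  - by move=> m; have [] := tight m.
  - by move=> m; have [] := tight m.
  - move=> m i; have /andP[-> mud] := mu_bound m i.
    by rewrite (le_trans mud) // ge_min lexx.
  - by move=> j jk; have [] := qsP n.+1 j jk.
  - move=> l nl; have om_l := neighbour_min_le om nl; split.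
      apply: (@le_trans _ _ (neighbour_min om l / 2)); last by lra.
      by rewrite ge_min lexx.
    apply: (@le_trans _ _ (\sum_(i < M l) d l)).
      by apply: ler_sum => i _; have /andP[] := mu_bound l i.
    rewrite sumr_const card_ord -[leLHS]mulr_natr.
    apply: (@le_trans _ _ (neighbour_min om l / 2)); last by lra.
    by rewrite -ler_pdivlMr ?ltr0n // ge_min lexx orbT.
  - have -> : \sum_(j < plan n.+1) (rs n.+1 j)%:R * ((qs n.+1 j)%:R
        * (2 * (M n.+1)%:R * ((4 * (M n.+1)%:R + 7) * h n.+1)))
        = fine n.+1 * h n.+1.
      by rewrite /fine mulr_suml; apply: eq_bigr => j _; ring.
    apply: (@le_trans _ _ ((fine n.+1 + 1) * h n.+1)).
      by rewrite ler_pM2r // lerDl.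
    by rewrite mulrC -ler_pdivlMr ?ltr_wpDl // ge_min lexx orbT.
have [W WP] := choice stage.
have [|n|n i|n|k [z [k_inf z0 zS z_div]]] := @divergent_iterates R s H K Lt
  (fun n => v (axis n.+1) A) W A Lt_closed.
- by move=> n; exact: v_unit.
- by apply: v_perp; apply/eqP => -[/n_Sn].
- by have [] := WP n.
- by have [] := WP n.
exists Lt, (v (axis 1) A), k, z; split=> // i; split=> //.
apply: perpK_sub => //; exact: generators_sub.
Qed.
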